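(* Fix $r\ge1$ and an $r$-tuple $\mathbf{k}=(k_1,\dots,k_r)$ of non-negative integers. Let $X_{\mathbf{k}}(n)$ be the number of ordered $r$-tuples $(v_1,\dots,v_r)$ of distinct vertices of $T_n$ such that $v_i$ has rank $k_i$ for each $i$. Then $$\mathbb{E}[X_{\mathbf{k}}(n)]=\big(1+O(n^{-1})\big)\,n^r\prod_{j=1}^r c_{k_j}.$$
   Context: A plane increasing tree on $[n]$ is a rooted tree with vertex set $[n]$ in which every non-root vertex has a larger label than its parent (the root is $1$) and the children of each vertex are linearly ordered. Let $T_n$ be uniformly random among the $(2n-3)!!$ such trees. The rank of a vertex $v$ is the number of edges of a shortest path from $v$ down to a leaf descendant of $v$. Let $b_k(n)$ be the number of plane increasing trees on $[n]$ whose root has rank $k$, $B_k(z)=\sum_{n\ge1}b_k(n)z^n/n!$, and $c_k:=2\int_0^{1/2}\sqrt{1-2\xi}\,B_k'(\xi)\,d\xi$; equivalently $c_k=\lim_{n\to\infty}n^{-1}\mathbb{E}[\#\{\text{vertices of rank }k\text{ in }T_n\}]$. *)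

(* Defs.v *)
From HB Require Import structures.
From mathcomp Require Import all_boot all_order all_algebra.
From mathcomp Require Import all_classical all_reals all_analysis.

Set Implicit Arguments.
Unset Strict Implicit.
Unset Printing Implicit Defensive.

Import Order.TTheory GRing.Theory Num.Theory.
Import numFieldNormedType.Exports.

Local Open Scope ring_scope.

(* The label set [n] = {1, ..., n} is represented by 'I_n = {0, ..., n-1}, so
   the root, labelled 1, is the vertex of value 0. A plane increasing tree
   is given by its parent function (None at the root) together with the set of
   pairs (u, v) of distinct siblings such that u precedes v. *)
Definition is_pit (n : nat)
    (t : {ffun 'I_n -> option 'I_n} * {set 'I_n * 'I_n}) : bool :=
  let: (p, s) := t in
  [&& [forall v : 'I_n, (p v == None) == (v == 0%N :> nat)],
      [forall v : 'I_n, forall u : 'I_n, (p v == Some u) ==> (u < v)%N],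
      [forall u, forall v, ((u, v) \in s) ==> (u != v) && (p u == p v)],
      [forall u, forall v, forall w,
         ((u, v) \in s) && ((v, w) \in s) ==> ((u, w) \in s)] &
      [forall u, forall v,
         (u != v) && (p u == p v) ==> ((u, v) \in s) || ((v, u) \in s)]].

Record pit (n : nat) := Pit {
  pit_val :> {ffun 'I_n -> option 'I_n} * {set 'I_n * 'I_n};
  pit_valP : is_pit pit_val
}.

HB.instance Definition _ n := [isSub for @pit_val n].
HB.instance Definition _ n := [Finite of pit n by <:].

Section Rank.
Variables (n : nat) (t : pit n).

Definition parent (v : 'I_n) : option 'I_n := (pit_val t).1 v.

Definition is_root (v : 'I_n) : bool := parent v == None.

Definition edge : rel 'I_n := fun u v => parent v == Some u.

Definition leaf (v : 'I_n) : bool := [forall u, ~~ edge v u].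

Definition leaf_path (v : 'I_n) (k : nat) : bool :=
  [exists p : k.-tuple 'I_n, path edge v p && leaf (last v p)].

Lemma edge_lt (u v : 'I_n) : edge u v -> (u < v)%N.
Proof.
rewrite /edge /parent; case: t => -[p s] /= /and5P[_ /forallP/(_ v) lt_v _ _ _].
by move: lt_v => /forallP/(_ u)/implyP.
Qed.

Lemma ex_leaf_path (v : 'I_n) : exists k, leaf_path v k.
Proof.
have [m] := ubnP (n - v); elim: m v => // m IHm v ltvm.
have [lv|] := boolP (leaf v).
  by exists 0%N; apply/existsP; exists [tuple]; rewrite /= lv.
rewrite negb_forall => /existsP[u]; rewrite negbK => evu.
have ltuv := edge_lt evu.
have [|k /existsP[p /andP[up lp]]] := IHm u.
  by rewrite -ltnS (leq_trans _ ltvm) // ltnS ltn_sub2l.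
by exists k.+1; apply/existsP; exists [tuple of u :: p]; rewrite /= evu up lp.
Qed.

Definition rank (v : 'I_n) : nat := ex_minn (ex_leaf_path v).

End Rank.

Definition b (k n : nat) : nat :=
  #|[set t : pit n | [exists v : 'I_n, is_root t v && (rank t v == k)]]|.

Section Constants.
Variable R : realType.

(* The term of index 0 vanishes: a tree on the empty set has no root. *)
Definition B (k : nat) (z : R) : R :=
  limn (pseries (fun n => (b k n)%:R / n`!%:R) z).

(* The integrand is 0 at 1/2, whatever the value of derive1 (B k) there. *)
Definition c (k : nat) : R :=
  2 * (\int[@lebesgue_measure R]_(x in `[0, 2^-1]%classic)
         (Num.sqrt (1 - 2 * x) * derive1 (B k) x)).

Definition unif_expectation (T : finType) (f : T -> R) : R :=
  (\sum_(x : T) f x) / #|T|%:R.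

End Constants.

Definition X (r : nat) (k : r.-tuple nat) (n : nat) (t : pit n) : nat :=
  #|[set v : r.-tuple 'I_n |
      uniq v && [forall i : 'I_r, rank t (tnth v i) == tnth k i]]|.

(* Main.v *)
Require Import Defs.
From HB Require Import structures.
From mathcomp Require Import all_boot all_order all_algebra.
From mathcomp Require Import all_classical all_reals all_analysis.
From mathcomp Require Import measurable_realfun ring lra zify.

(** Encode a plane increasing tree by the ordered forest of its root's children,
    each forest being a binary tree (first child, later siblings).  Inserting the
    label [n.+1] at one of the [2n-1] corners of a tree on [[n]] gives every tree
    on [[n+1]] exactly once, so a uniform tree grows by uniform insertions.

    Mean: tracking the insertions that hit a given fringe subtree shows that the
    expected number of vertices of [T_n] whose subtree has size [i < n] is
    [(2n-1)/(4i^2-1)], the subtree being uniform; hence the number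
    [N_k] of vertices of rank [k] satisfies [E N_k = n c_k + O(1)] with
    [c_k = sum_i 2 P(root of T_i has rank k)/(4i^2-1)], and this series is
    the integral defining [c_k], integrated term by term.

    Variance: rank [k] is a local property, so moving a grafted block of a tree to
    another corner changes [N_k] by [O(k)].  Insertions into two trees that differ
    by such a move can be coupled to preserve this relation, so that [N_k] has
    bounded martingale differences along the growth and [Var N_k = O(n)].

    Finally [N_k/n] is bounded, with bias and mean square error [O(1/n)]; these
    properties are stable under products, and the tuples with a repeated vertex
    are only [O(n^(r-1))]. *)

Set Implicit Arguments.
Unset Strict Implicit.
Unset Printing Implicit Defensive.
Import Order.TTheory GRing.Theory Num.Theory.
Import numFieldNormedType.Exports.
Local Open Scope ring_scope.

(** * Growth of forests *)

(* In [FCons a l r], the first tree has root [a] and child forest [l], and [r]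
   consists of the remaining trees. *)
Inductive forest (T : Type) := FNil | FCons of T & forest T & forest T.
Arguments FNil {T}.

HB.instance Definition _ (T : Type) := gen_eqMixin (forest T).

Fixpoint fsize (T : Type) (F : forest T) : nat :=
  if F is FCons _ l r then (fsize l + fsize r).+1 else 0%N.

Fixpoint fmap (T U : Type) (h : T -> U) (F : forest T) : forest U :=
  if F is FCons a l r then FCons (h a) (fmap h l) (fmap h r) else FNil.

Fixpoint fcat (T : Type) (F G : forest T) : forest T :=
  if F is FCons a l r then FCons a l (fcat r G) else G.

Definition is_nil (T : Type) (F : forest T) : bool :=
  if F is FNil then true else false.

(** A forest stands for the tree obtained by hanging its trees below a virtual root. The corners of
    that tree are enumerated starting with the leftmost top one, so each position of a new leaf
    occurs once. *)
Fixpoint ins (T : Type) (x : T) (F : forest T) : seq (forest T) :=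
  if F is FCons a l r then
    FCons x FNil F ::
      [seq FCons a l' r | l' <- ins x l] ++ [seq FCons a l r' | r' <- ins x r]
  else [:: FCons x FNil FNil].

Lemma ins_head (T : Type) (x : T) (F : forest T) :
  ins x F = FCons x FNil F :: behead (ins x F).
Proof. by case: F. Qed.

Lemma size_ins (T : Type) (x : T) (F : forest T) :
  size (ins x F) = (2 * fsize F).+1.
Proof.
by elim: F => //= a l IHl r IHr; rewrite size_cat !size_map IHl IHr; lia.
Qed.

Lemma fsize_ins (T : Type) (x : T) (F F' : forest T) :
  F' \in ins x F -> fsize F' = (fsize F).+1.
Proof.
elim: F F' => [|a l IHl r IHr] F' /=.
  by rewrite inE => /eqP->.
rewrite inE mem_cat => /or3P[/eqP->//|/mapP[l' /IHl e ->]|/mapP[r' /IHr e ->]];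
  by rewrite /= e; lia.
Qed.

(** A shape occurs once for each of its increasing labellings, so a uniform entry is the shape of a
    uniform tree on [m.+1] vertices. *)
Definition shapes (m : nat) : seq (forest unit) :=
  iter m (fun S => flatten (map (ins tt) S)) [:: FNil].

Lemma fsize_shapes (m : nat) (F : forest unit) : F \in shapes m -> fsize F = m.
Proof.
elim: m F => [|m IHm] F; first by rewrite inE => /eqP->.
rewrite [shapes _]/= => /flatten_mapP [s sm Fs].
by rewrite (fsize_ins Fs) (IHm s).
Qed.

Lemma size_shapesS (m : nat) :
  size (shapes m.+1) = ((2 * m).+1 * size (shapes m))%N.
Proof.
rewrite /= size_flatten /shape -map_comp sumnE big_map.
rewrite (eq_big_seq (fun=> (2 * m).+1)); last first.
  by move=> F /fsize_shapes Fm; rewrite /= size_ins Fm.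
by rewrite big_const_seq count_predT iter_addn_0 mulnC.
Qed.

Lemma size_shapes_gt0 (m : nat) : (0 < size (shapes m))%N.
Proof. by elim: m => // m IHm; rewrite size_shapesS muln_gt0. Qed.

Section Growth.
Variable R : realFieldType.
Implicit Types (f g : forest unit -> R).

Definition shape_sum (m : nat) (f : forest unit -> R) : R := \sum_(F <- shapes m) f F.
Definition shape_mean (m : nat) (f : forest unit -> R) : R := shape_sum m f / (size (shapes m))%:R.
Definition insum (f : forest unit -> R) (F : forest unit) : R :=
  \sum_(F' <- ins tt F) f F'.

Lemma shape_sumS (m : nat) f : shape_sum m.+1 f = shape_sum m (insum f).
Proof.
rewrite /shape_sum /= big_flatten big_map.
by apply: eq_bigr => F _; rewrite /insum.
Qed.

Lemma eq_shape_sum (m : nat) f g :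
  (forall F, fsize F = m -> f F = g F) -> shape_sum m f = shape_sum m g.
Proof. by move=> fg; apply: eq_big_seq => F /fsize_shapes/fg. Qed.

Lemma natr_size_shapesS (m : nat) :
  (size (shapes m.+1))%:R = (2 * m%:R + 1) * (size (shapes m))%:R :> R.
Proof. by rewrite size_shapesS natrM -natr1 natrM. Qed.

Lemma natr_size_shapes_neq0 (m : nat) : (size (shapes m))%:R != 0 :> R.
Proof. by rewrite pnatr_eq0 -lt0n size_shapes_gt0. Qed.

Lemma natr_size_shapes_gt0 (m : nat) : 0 < (size (shapes m))%:R :> R.
Proof. by rewrite ltr0n size_shapes_gt0. Qed.

(** An additive functional of the fringe subtrees; the virtual root contributes nothing. *)
Fixpoint nodesum (T : Type) (f : forest T -> R) (F : forest T) : R :=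
  if F is FCons _ l r then f l + nodesum f l + nodesum f r else 0.

Lemma nodesum_sum (I : Type) (s : seq I) (f : I -> forest unit -> R) F :
  nodesum (fun G => \sum_(i <- s) f i G) F = \sum_(i <- s) nodesum (f i) F.
Proof.
elim: F => [|a l IHl r IHr] /=; first by rewrite big1.
by rewrite IHl IHr -!big_split.
Qed.

Definition sized (i : nat) (f : forest unit -> R) (F : forest unit) : R :=
  if fsize F == i then f F else 0.

Lemma nodesum_sized (m : nat) f F : (fsize F <= m)%N ->
  nodesum f F = \sum_(i < m) nodesum (sized i f) F.
Proof.
rewrite -(big_mkord xpredT (fun i => nodesum (sized i f) F)) -nodesum_sum.
elim: F => //= a l IHl r IHr ltm.
rewrite -IHl ?IHr; try lia.
congr (_ + _ + _); rewrite big_mkord /sized.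
have lm : (fsize l < m)%N by lia.
rewrite (bigD1 (Ordinal lm)) //= eqxx big1 ?addr0// => i /negP/negP ni.
by rewrite ifN// eq_sym.
Qed.

Lemma insum_sized (i : nat) f F :
  insum (sized i.+1 f) F = sized i (insum f) F.
Proof.
rewrite /insum /sized; case: eqP => [e|ne].
  by apply: eq_big_seq => F' F'i /=; rewrite (fsize_ins F'i) e eqxx.
rewrite big_seq big1// => F' F'i.
by rewrite (fsize_ins F'i) eqSS; case: eqP.
Qed.

Lemma insum_sized0 f F : insum (sized 0 f) F = 0.
Proof. by rewrite /insum big_seq big1// => F' F'i; rewrite /sized (fsize_ins F'i). Qed.

Lemma sumr_cst (T : Type) (s : seq T) (x : R) : \sum_(i <- s) x = (size s)%:R * x.
Proof. by rewrite big_const_seq count_predT iter_addr_0 mulr_natl. Qed.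

(** Count corners. The new leaf contributes [f FNil] at every corner; for a node with child forest
    [G], the [2|G|+1] corners in [G] give [insum f G], and the other [2(|F|-|G|)] leave [G]
    unchanged. *)
Lemma insum_nodesum f F :
  insum (nodesum f) F =
    (2 * (fsize F)%:R + 1) * f FNil + nodesum (insum f) F +
    nodesum (fun G => (2 * ((fsize F)%:R - (fsize G)%:R)) * f G) F.
Proof.
suff H (c : R) : c = (fsize F)%:R ->
    insum (nodesum f) F = (2 * (fsize F)%:R + 1) * f FNil +
      nodesum (insum f) F +
      nodesum (fun G => (2 * (c - (fsize G)%:R)) * f G) F by exact: H.
move=> ->{c}; rewrite /insum.
elim: F => [|a l IHl r IHr] /=.
  by rewrite big_seq1 /=; ring.
(* The induction hypotheses carry the sizes of [l] and [r]; this changes them to the size of the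
   whole forest. *)
have shift (x y : R) F : nodesum (fun G => (2 * (x - (fsize G)%:R)) * f G) F =
   nodesum (fun G => (2 * (y - (fsize G)%:R)) * f G) F + 2 * (x - y) * nodesum f F.
  elim: F => [|b k IHk t IHt] /=; first by ring.
  by rewrite IHk IHt; ring.
rewrite big_cons big_cat !big_map /= !big_split /= !sumr_cst !size_ins IHl IHr.
rewrite (shift (fsize l + fsize r).+1%:R (fsize l)%:R l).
rewrite (shift (fsize l + fsize r).+1%:R (fsize r)%:R r).
rewrite -(natr1 (fsize l + fsize r)) -(natr1 (2 * fsize l)) -(natr1 (2 * fsize r)).
by rewrite !natrM !natrD; ring.
Qed.

(** Once the size of [G] is fixed to [i], the weight in [insum_nodesum] is constant and factors
    out. *)
Lemma insum_nodesum_sized i f F :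
  insum (nodesum (sized i f)) F =
    (i == 0%N)%:R * (2 * (fsize F)%:R + 1) * f FNil + nodesum (insum (sized i f)) F +
    (2 * ((fsize F)%:R - i%:R)) * nodesum (sized i f) F.
Proof.
rewrite insum_nodesum; congr (_ + _ + _).
  by rewrite /sized /=; case: i => [|i] /=; ring.
move: (fsize F)%:R => x; elim: F => [|b k IHk t IHt] /=; first by ring.
by rewrite IHk IHt /sized; case: eqP => [->|_]; ring.
Qed.

Lemma shape_sum_lin (m : nat) (x : R) f g :
  shape_sum m (fun F => x * f F + g F) = x * shape_sum m f + shape_sum m g.
Proof. by rewrite /shape_sum big_split mulr_sumr. Qed.

Lemma eq_nodesum f g F : f =1 g -> nodesum f F = nodesum g F.
Proof. by move=> fg; elim: F => //= a l -> r ->; rewrite fg. Qed.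

(** Recurrence on [m]: subtrees of size [i] persist with weight [2(m-i)], and new ones come from
    size [i-1] by an insertion or, for [i = 0], from the new leaf. *)
Lemma shape_sum_nodesum_sized (m i : nat) f : (i < m)%N ->
  shape_sum m (nodesum (sized i f)) =
    (size (shapes m))%:R * ((2 * m%:R + 1) / ((2 * i%:R + 1) * (2 * i%:R + 3))) * shape_mean i f.
Proof.
elim: m i f => // m IHm i f; rewrite ltnS => leim.
rewrite shape_sumS (@eq_shape_sum _ _ (fun F => 2 * (m%:R - i%:R) * nodesum (sized i f) F +
    ((i == 0%N)%:R * (2 * m%:R + 1) * f FNil + nodesum (insum (sized i f)) F))); last first.
  by move=> F <-; rewrite insum_nodesum_sized addrC.
rewrite shape_sum_lin.
have pos (j : nat) (x : R) : 0 < x -> 2 * j%:R + x != 0.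
  by move=> x0; rewrite gt_eqF// ltr_wpDl// mulr_ge0.
have -> : 2 * (m%:R - i%:R) * shape_sum m (nodesum (sized i f)) =
  2 * (m%:R - i%:R) * ((size (shapes m))%:R *
    ((2 * m%:R + 1) / ((2 * i%:R + 1) * (2 * i%:R + 3))) * shape_mean i f).
  move: leim; rewrite leq_eqVlt => /predU1P[->|lt_im]; last by rewrite IHm.
  by rewrite subrr mulr0 !mul0r.
have -> : shape_sum m (fun F => (i == 0)%:R * (2 * m%:R + 1) * f FNil + nodesum (insum (sized i f)) F)
  = (size (shapes m))%:R * ((2 * m%:R + 1) / (2 * i%:R + 1)) * shape_mean i f.
  case: i leim => [|i] leim.
    rewrite (@eq_shape_sum _ _ (fun=> (2 * m%:R + 1) * f FNil)); last first.
      move=> F _; rewrite mul1r (@eq_nodesum _ (fun=> 0)); last exact: insum_sized0.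
      rewrite [nodesum _ _](_ : _ = 0) ?addr0//.
      by elim: F => //= _ l -> r ->; rewrite !addr0.
    rewrite /shape_mean /shape_sum sumr_cst big_seq1 /=; by field.
  (* Enlarging subtrees of size [i] to size [i.+1] turns [f] into [insum f], whose total over
     [shapes i] is that of [f] over [shapes i.+1]. *)
  rewrite (@eq_shape_sum _ _ (nodesum (sized i (insum f)))); last first.
    move=> F _; rewrite !mul0r add0r; apply: eq_nodesum => G; exact: insum_sized.
  rewrite IHm// /shape_mean -shape_sumS natr_size_shapesS -(natr1 i).
  have h1 : 2 * (i%:R + 1) + 1 != 0 :> R by rewrite natr1 pos.
  by field; rewrite h1 natr_size_shapes_neq0 !pos.
rewrite natr_size_shapesS -(natr1 m); field.
by rewrite !pos.
Qed.

Lemma mean_nodesum (m : nat) f :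
  shape_mean m (nodesum f) =
    (2 * m%:R + 1) * \sum_(i < m) shape_mean i f / ((2 * i%:R + 1) * (2 * i%:R + 3)).
Proof.
rewrite {1}/shape_mean (@eq_shape_sum _ _ (fun F => \sum_(i < m) nodesum (sized i f) F)); last first.
  by move=> F Fm; apply: nodesum_sized; rewrite Fm.
rewrite /shape_sum exchange_big /= mulr_suml mulr_sumr; apply: eq_bigr => i _.
rewrite -/(shape_sum m _) shape_sum_nodesum_sized//.
have pos (x : R) : 0 < x -> 2 * i%:R + x != 0.
  by move=> x0; rewrite gt_eqF// ltr_wpDl// mulr_ge0.
by field; rewrite !pos ?natr_size_shapes_neq0.
Qed.

End Growth.

(** * Coupling and variance *)

(* [F'] is [F] with the block [B] inserted at a corner that has [d] ancestors. *)
Inductive grafted (T : Type) (B : forest T) :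
    nat -> forest T -> forest T -> Prop :=
| grafted_top F : grafted B 0 F (fcat B F)
| grafted_left d a l r l' :
    grafted B d l l' -> grafted B d.+1 (FCons a l r) (FCons a l' r)
| grafted_right d a l r r' :
    grafted B d r r' -> grafted B d (FCons a l r) (FCons a l r').

Definition graft (T : Type) (B F F' : forest T) : Prop :=
  exists d, grafted B d F F'.

Section Coupling.
Variables (R : realFieldType) (T : Type).
Implicit Types (B F : forest T) (f : forest T -> R).

(** The rightmost top corner of [B] and the leftmost top corner of [F] merge into one; it is counted
    with [B], and [behead] removes it from [ins x F]. *)
Lemma sum_ins_fcat f x B F :
  \sum_(G <- ins x (fcat B F)) f G =
    \sum_(B' <- ins x B) f (fcat B' F) + \sum_(F' <- behead (ins x F)) f (fcat B F').
Proof.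
elim: B f => [|a l IHl r IHr] f /=.
  by rewrite ins_head big_cons big_seq1.
by rewrite !big_cons !big_cat !big_map /= IHr !addrA.
Qed.

Lemma Forall2_map (I J I' J' : Type) (P : I -> J -> Prop) (Q : I' -> J' -> Prop)
    (h : I -> I') (k : J -> J') s t :
  (forall x y, P x y -> Q (h x) (k y)) ->
  List.Forall2 P s t -> List.Forall2 Q (map h s) (map k t).
Proof. by move=> PQ; elim=> [|x y s' t' xy _ IH] /=; constructor; auto. Qed.

Lemma Forall2_same (I I' J' : Type) (Q : I' -> J' -> Prop)
    (h : I -> I') (k : I -> J') s :
  (forall x, Q (h x) (k x)) -> List.Forall2 Q (map h s) (map k s).
Proof. by move=> PQ; elim: s => [|x s IH] /=; constructor; auto. Qed.

(* The corners of a tree with block [B] grafted onto [F] are those of [F] and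
   those inside [B]: a new leaf either enlarges [F] or enlarges [B]. *)
Lemma grafted_ins x B d F F' : grafted B d F F' ->
  exists L1 L2,
    [/\ List.Forall2 (fun B' G => graft B' F G) (behead (ins x B)) L1,
        List.Forall2 (graft B) (ins x F) L2 &
        forall f, \sum_(G <- ins x F') f G = \sum_(G <- L1) f G + \sum_(G <- L2) f G].
Proof.
elim=> {d F F'} [F|d a l r l' gl [L1 [L2 [H1 H2 H3]]]|d a l r r' gr [L1 [L2 [H1 H2 H3]]]].
- exists [seq fcat B' F | B' <- behead (ins x B)].
  exists (FCons x FNil (fcat B F) :: [seq fcat B F' | F' <- behead (ins x F)]).
  split.
  + rewrite -[X in List.Forall2 _ X]map_id; apply: Forall2_same => B'.
    by exists 0%N; constructor.
  + rewrite ins_head; constructor.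
      by exists 0%N; do 2 constructor.
    rewrite -[X in List.Forall2 _ X]map_id; apply: Forall2_same => B'.
    by exists 0%N; constructor.
  + move=> f; rewrite sum_ins_fcat (ins_head x B) !big_cons !big_map /=.
    by ring.
- exists [seq FCons a l1 r | l1 <- L1].
  exists (FCons x FNil (FCons a l' r) ::
    [seq FCons a l1 r | l1 <- L2] ++ [seq FCons a l' r1 | r1 <- ins x r]).
  split.
  + rewrite -[X in List.Forall2 _ X]map_id; apply: Forall2_map H1 => B' G [e ?].
    by exists e.+1; constructor.
  + constructor; first by exists d.+1; do 2 constructor.
    apply: List.Forall2_app.
      by apply: Forall2_map H2 => G G' [e ?]; exists e.+1; constructor.
    by apply: Forall2_same => G; exists d.+1; constructor.
  + by move=> f; rewrite !big_cons !big_cat !big_map /= H3; ring.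
- exists [seq FCons a l r1 | r1 <- L1].
  exists (FCons x FNil (FCons a l r') ::
    [seq FCons a l1 r' | l1 <- ins x l] ++ [seq FCons a l r1 | r1 <- L2]).
  split.
  + rewrite -[X in List.Forall2 _ X]map_id; apply: Forall2_map H1 => B' G [e ?].
    by exists e; constructor.
  + constructor; first by exists d; do 2 constructor.
    apply: List.Forall2_app.
      by apply: Forall2_same => G; exists d; constructor.
    by apply: Forall2_map H2 => G G' [e ?]; exists e; constructor.
  + by move=> f; rewrite !big_cons !big_cat !big_map /= H3; ring.
Qed.

Lemma Forall2_sum_dist (I J : Type) (P : I -> J -> Prop) (f : J -> R) (C : R)
    (s : seq I) (t t' : seq J) :
  (forall i j j', P i j -> P i j' -> `|f j - f j'| <= C) ->
  List.Forall2 P s t -> List.Forall2 P s t' ->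
  `|\sum_(j <- t) f j - \sum_(j <- t') f j| <= (size s)%:R * C.
Proof.
move=> Pf H; elim: H t' => [|i j s' t1 ij _ IH] t' H'; inversion H'; subst.
  by rewrite !big_nil subr0 normr0 mul0r.
rewrite !big_cons opprD addrACA /= -natr1 mulrDl mul1r addrC.
by rewrite (le_trans (ler_normD _ _))// lerD// ?IH//; apply: Pf ij _.
Qed.

(** The block is arbitrary rather than a single leaf, since insertions may enlarge the moved part;
    this makes the condition stable under [avg]. *)
Definition lip (C : R) (f : forest T -> R) : Prop :=
  forall B F G G', graft B F G -> graft B F G' -> `|f G - f G'| <= C.

Lemma fsize_fcat B F : fsize (fcat B F) = (fsize B + fsize F)%N.
Proof. by elim: B => //= a l _ r ->; lia. Qed.

Lemma fsize_graft B F G : graft B F G -> fsize G = (fsize B + fsize F)%N.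
Proof.
case=> d; elim=> {d F G} [F|d a l r l' _ IH|d a l r l' _ IH] /=.
- exact: fsize_fcat.
- by rewrite IH; lia.
- by rewrite IH; lia.
Qed.

(** Conditional expectation of [f] given the forest before the last insertion. *)
Definition avg (x : T) (f : forest T -> R) (F : forest T) : R :=
  (\sum_(G <- ins x F) f G) / (2 * fsize F).+1%:R.

(** By [grafted_ins] the corners of [G] and [G'] pair up: [2|B|] pairs enlarge the same block and
    [2|F|+1] pairs enlarge the same [F]. The members of a pair are again two graftings of a common
    block onto a common forest. *)
Lemma lip_avg x C f : lip C f -> lip C (avg x f).
Proof.
move=> lf B F G G' gG gG'.
rewrite /avg (fsize_graft gG) (fsize_graft gG') -mulrBl normrM.
rewrite [X in _ * X]gtr0_norm ?invr_gt0 ?ltr0n// ler_pdivrMr ?ltr0n//.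
case: gG => d /(grafted_ins x) [L1 [L2 [H1 H2 ->]]].
case: gG' => d' /(grafted_ins x) [L1' [L2' [H1' H2' ->]]].
rewrite opprD addrACA (le_trans (ler_normD _ _))//.
have -> : (2 * (fsize B + fsize F)).+1%:R = (2 * fsize B)%:R + (2 * fsize F).+1%:R :> R.
  by rewrite -natrD; congr (_%:R); lia.
rewrite mulrDr lerD//.
  have := Forall2_sum_dist _ H1 H1'; rewrite size_behead size_ins mulrC; apply.
  by move=> B' K K'; apply: lf.
by have := Forall2_sum_dist _ H2 H2'; rewrite size_ins mulrC; apply=> F' K K'; apply: lf.
Qed.

Lemma graft_ins x F G : G \in ins x F -> graft (FCons x FNil FNil) F G.
Proof.
elim: F G => [|a l IHl r IHr] G /=.
  by rewrite inE => /eqP->; exists 0%N; constructor.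
rewrite inE mem_cat => /or3P[/eqP->|/mapP[l' l'l ->]|/mapP[r' r'r ->]].
- by exists 0%N; apply: (grafted_top (FCons x FNil FNil)).
- by have [d ?] := IHl _ l'l; exists d.+1; constructor.
- by have [d ?] := IHr _ r'r; exists d; constructor.
Qed.

(** All outcomes of one insertion graft a single leaf onto [F], so they lie within [C] of any one of
    them; and a variance is at most the mean square distance to a fixed value. *)
Lemma avg_var x C f F : lip C f ->
  avg x (fun G => f G ^+ 2) F - avg x f F ^+ 2 <= C ^+ 2.
Proof.
move=> lf.
set a := f (FCons x FNil F).
have w0 : (2 * fsize F).+1%:R != 0 :> R by rewrite pnatr_eq0.
have -> : avg x (fun G => f G ^+ 2) F - avg x f F ^+ 2 =
    avg x (fun G => (f G - a) ^+ 2) F - (avg x f F - a) ^+ 2.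
  have -> : avg x (fun G => (f G - a) ^+ 2) F =
    avg x (fun G => f G ^+ 2) F - 2 * a * avg x f F + a ^+ 2.
    rewrite /avg (eq_bigr (fun G => f G ^+ 2 + (- (2 * a) * f G + a ^+ 2))); last first.
      by move=> G _; ring.
    rewrite big_split big_split /= sumr_cst size_ins -mulr_sumr.
    by move: (2 * fsize F).+1%:R (\sum_(G <- _) _) (\sum_(G <- _) _) w0 => w u v w0; field.
  by move: (avg _ _ _) (avg _ _ _) a => u v y; ring.
rewrite lerBlDr ler_wpDr ?sqr_ge0// /avg ler_pdivrMr ?ltr0n//.
rewrite mulrC -(size_ins x) -sumr_cst big_seq [leRHS]big_seq ler_sum// => G Gi.
rewrite -[leLHS]real_normK ?num_real// ler_sqr ?nnegrE//.
  apply: lf (graft_ins Gi) (graft_ins _); by rewrite ins_head mem_head.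
(* [C] is nonnegative because it bounds a norm. *)
have gx : graft (FCons x FNil FNil) F (FCons x FNil F) by apply: graft_ins; rewrite ins_head mem_head.
by rewrite (le_trans _ (lf _ _ _ _ gx gx)).
Qed.

End Coupling.

Section Variance.
Variable R : realFieldType.

Lemma meanS (m : nat) (f : forest unit -> R) : shape_mean m.+1 f = shape_mean m (avg tt f).
Proof.
rewrite /shape_mean shape_sumS natr_size_shapesS /shape_sum.
rewrite (@eq_big_seq _ _ _ _ _ (avg tt f) (fun F => insum f F / (2 * m%:R + 1))).
  by rewrite -mulr_suml invfM mulrA.
by move=> F /fsize_shapes e; rewrite /avg e -natr1 natrM.
Qed.

Lemma mean_le (m : nat) (f g : forest unit -> R) :
  (forall F, f F <= g F) -> shape_mean m f <= shape_mean m g.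
Proof. by move=> fg; rewrite ler_pM2r ?invr_gt0 ?natr_size_shapes_gt0// ler_sum. Qed.

Lemma mean_cst (m : nat) (c : R) : shape_mean m (fun=> c) = c.
Proof. by rewrite /shape_mean /shape_sum sumr_cst mulrC mulKf ?natr_size_shapes_neq0. Qed.

Lemma meanD (m : nat) (f g : forest unit -> R) :
  shape_mean m (fun F => f F + g F) = shape_mean m f + shape_mean m g.
Proof. by rewrite /shape_mean /shape_sum big_split mulrDl. Qed.

(* Conditional variance formula: the last insertion contributes at most [C ^+ 2],
   and conditioning on the others amounts to replacing [f] by [avg tt f]. *)
Lemma lip_variance (m : nat) (C : R) (f : forest unit -> R) : lip C f ->
  shape_mean m (fun F => f F ^+ 2) - shape_mean m f ^+ 2 <= m%:R * C ^+ 2.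
Proof.
elim: m f => [|m IHm] f lf.
  by rewrite /shape_mean /shape_sum !big_seq1 /= !divr1 subrr mul0r.
rewrite !meanS -natr1 mulrDl mul1r.
have := IHm _ (lip_avg tt lf).
have : shape_mean m (avg tt (fun F => f F ^+ 2)) <= shape_mean m (fun F => C ^+ 2 + avg tt f F ^+ 2).
  by apply: mean_le => F; have := avg_var tt F lf; rewrite lerBlDr.
rewrite meanD mean_cst; lra.
Qed.

End Variance.

(** * Locality of the rank *)

(* Some leaf lies exactly [j] edges below some root of [F]. *)
Fixpoint leafdist (T : Type) (F : forest T) (j : nat) : bool :=
  if F is FCons _ l r then
    (if j is i.+1 then leafdist l i else is_nil l) || leafdist r j
  else false.

(* A vertex with child forest [F] has a leaf exactly [j] edges below it. *)
Definition lpath (T : Type) (F : forest T) (j : nat) : bool :=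
  if j is i.+1 then leafdist F i else is_nil F.

Definition has_rank (T : Type) (k : nat) (F : forest T) : bool :=
  lpath F k && [forall i : 'I_k, ~~ lpath F i].

Lemma leafdist_cons (T : Type) (a : T) l r j :
  leafdist (FCons a l r) j = lpath l j || leafdist r j.
Proof. by case: j. Qed.

Section RankLip.
Variables (R : realFieldType) (T : Type).
Implicit Types (B F : forest T).

(** New vertices lie at depth greater than [d], counted from the virtual root, and only a vertex at
    depth [d] can stop being a leaf. *)
Lemma grafted_lpath B d F F' j : grafted B d F F' -> (j < d)%N ->
  lpath F' j = lpath F j.
Proof.
move=> g; elim: g j => {d F F'} [//|d a l r l' _ IH|d a l r r' _ IH] [|j] //=.
  rewrite ltnS => /IH e; change (leafdist (FCons a l' r) j = leafdist (FCons a l r) j).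
  by rewrite !leafdist_cons e.
by move=> jd; have := IH j.+1 jd; rewrite /= => ->.
Qed.

Lemma grafted_has_rank B d F F' k : grafted B d F F' -> (k < d)%N ->
  has_rank k F' = has_rank k F.
Proof.
move=> g kd; rewrite /has_rank (grafted_lpath g kd); congr (_ && _).
apply: eq_forallb => i; rewrite (grafted_lpath g)//.
exact: ltn_trans kd.
Qed.

Definition rank_ind (k : nat) (F : forest T) : R := (has_rank k F)%:R.

Lemma rank_ind01 k F : 0 <= rank_ind k F <= 1.
Proof. by rewrite /rank_ind; case: has_rank; rewrite !lexx !ler01. Qed.

Lemma nodesum_fcat (f : forest T -> R) B F :
  nodesum f (fcat B F) = nodesum f B + nodesum f F.
Proof. by elim: B => [|a l _ r IH] /=; rewrite ?add0r// IH !addrA. Qed.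

(* Only the [k.+1] lowest ancestors of the graft can gain or lose rank [k]. *)
Lemma grafted_nodesum B d F F' k : grafted B d F F' ->
  `|nodesum (rank_ind k) F' - nodesum (rank_ind k) F - nodesum (rank_ind k) B|
    <= (minn d k.+1)%:R.
Proof.
elim=> {d F F'} [F|d a l r l' g IH|d a l r r' _ IH] /=.
- by rewrite nodesum_fcat min0n addrK subrr normr0.
- have -> : rank_ind k l' + nodesum (rank_ind k) l' + nodesum (rank_ind k) r
      - (rank_ind k l + nodesum (rank_ind k) l + nodesum (rank_ind k) r) - nodesum (rank_ind k) B
    = (nodesum (rank_ind k) l' - nodesum (rank_ind k) l - nodesum (rank_ind k) B) +
      (rank_ind k l' - rank_ind k l) by ring.
  (* The node with child forest [l] keeps its status when the graft is deeper than [k] below it;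
     otherwise it may cost one unit, which [minn] records. *)
  have [kd|dk] := ltnP k d.
    rewrite /rank_ind (grafted_has_rank g kd) subrr addr0 (le_trans IH)//.
    by rewrite ler_nat; lia.
  have -> : minn d.+1 k.+1 = (minn d k.+1).+1 by lia.
  rewrite -natr1 (le_trans (ler_normD _ _))// lerD//.
  by have := rank_ind01 k l; have := rank_ind01 k l'; rewrite ler_norml; lra.
- have -> : rank_ind k l + nodesum (rank_ind k) l + nodesum (rank_ind k) r'
      - (rank_ind k l + nodesum (rank_ind k) l + nodesum (rank_ind k) r) - nodesum (rank_ind k) B
    = (nodesum (rank_ind k) r' - nodesum (rank_ind k) r - nodesum (rank_ind k) B) by ring.
  by [].
Qed.

Definition rank_count (k : nat) (F : forest T) : R := rank_ind k F + nodesum (rank_ind k) F.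

(** Compare both graftings with the separate counts of [F] and [B]: each is off by at most [k+1],
    and the virtual root adds one more. *)
Lemma lip_rank_count k : lip (2 * k%:R + 3) (rank_count k).
Proof.
move=> B F G G' [d gG] [d' gG'].
have := grafted_nodesum k gG; have := grafted_nodesum k gG'.
have h e : (minn e k.+1)%:R <= k%:R + 1 :> R by rewrite natr1 ler_nat geq_minr.
have := h d; have := h d'; have := rank_ind01 k G; have := rank_ind01 k G'.
rewrite /rank_count !ler_norml; move: (nodesum _ _) (nodesum _ _) (nodesum _ _) => x y z.
lra.
Qed.

End RankLip.

(** * Plane increasing trees as forests *)

Section Labels.
Variable T : eqType.
Implicit Types (F l r : forest T).

Fixpoint tops F : seq T := if F is FCons a _ r then a :: tops r else [::].

Fixpoint labs F : seq T :=
  if F is FCons a l r then a :: labs l ++ labs r else [::].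

(* [K] gives the ordered list of children of each node of [F]. *)
Fixpoint fits (K : T -> seq T) F : bool :=
  if F is FCons a l r then [&& tops l == K a, fits K l & fits K r] else true.

Lemma fits_inj K F F' : fits K F -> fits K F' -> tops F = tops F' -> F = F'.
Proof.
elim: F F' => [|a l IHl r IHr] [|a' l' r'] //= /and3P[/eqP tl fl fr].
move=> /and3P[/eqP tl' fl' fr'] [eq_a eq_r]; subst a'.
by rewrite (IHl l')// ?tl ?tl'// (IHr r').
Qed.

Lemma fits_eq K K' F a : fits K F -> fits K' F -> a \in labs F -> K a = K' a.
Proof.
elim: F => //= b l IHl r IHr /and3P[/eqP tl fl fr] /and3P[/eqP tl' fl' fr'].
rewrite inE mem_cat => /or3P[/eqP->|al|ar]; last 2 first.
- exact: IHl.
- exact: IHr.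
- by rewrite -tl -tl'.
Qed.

(** Every occurrence of [v] is a root or a child of exactly one occurrence of a label. This count
    later yields both that each vertex occurs once and that children lists read off a forest define
    a tree. *)
Lemma count_labs K F v : fits K F ->
  count_mem v (labs F) =
    (count_mem v (tops F) + \sum_(a <- labs F) count_mem v (K a))%N.
Proof.
elim: F => [|a l IHl r IHr] /=; first by rewrite big_nil.
move=> /and3P[/eqP tl fl fr]; rewrite big_cons big_cat /= count_cat IHl// IHr//.
by rewrite -tl; lia.
Qed.

(** When labels are distinct, at most one occurrence of [a] contributes to the concatenation. *)
Fixpoint kids F (a : T) : seq T :=
  if F is FCons b l r then
    (if a == b then tops l else [::]) ++ kids l a ++ kids r a
  else [::].

Lemma kids_notin F a : a \notin labs F -> kids F a = [::].
Proof.
elim: F => //= b l IHl r IHr.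
by rewrite inE mem_cat !negb_or => /and3P[/negPf-> /IHl-> /IHr->].
Qed.

Lemma fits_kids F K : uniq (labs F) -> {in labs F, K =1 kids F} -> fits K F.
Proof.
elim: F => //= b l IHl r IHr.
rewrite mem_cat negb_or cat_uniq -!andbA => /and5P[bl br ul /hasPn lr ur] KE.
have lr' a : a \in labs l -> a \notin labs r.
  by move=> al; apply/negP => /lr; rewrite /= al.
apply/and3P; split.
- by rewrite KE ?mem_head//= eqxx (kids_notin bl) (kids_notin br) !cats0.
- apply: IHl => // a al; rewrite KE ?inE ?mem_cat ?al ?orbT//.
  rewrite (kids_notin (lr' a al)) cats0 ifN//.
  by apply: contraNneq bl => <-.
- apply: IHr => // a ar; rewrite KE ?inE ?mem_cat ?ar ?orbT//.
  rewrite (@kids_notin l); last by apply: (lr a ar).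
  rewrite ifN//.
  by apply: contraNneq br => <-.
Qed.

Lemma tops_labs F v : v \in tops F -> v \in labs F.
Proof.
elim: F => //= a l _ r IH; rewrite !inE mem_cat => /orP[->//|/IH->].
by rewrite !orbT.
Qed.

End Labels.

Lemma labs_fmap (T U : eqType) (h : T -> U) (F : forest T) :
  labs (fmap h F) = map h (labs F).
Proof. by elim: F => //= a l -> r ->; rewrite map_cat. Qed.

Lemma fmap_comp (T U V : Type) (h : T -> U) (g : U -> V) (F : forest T) :
  fmap g (fmap h F) = fmap (g \o h) F.
Proof. by elim: F => //= a l -> r ->. Qed.

Lemma fmap_inj (T U : Type) (h : T -> U) : injective h -> injective (fmap h).
Proof.
by move=> hI; elim=> [|a l IHl r IHr] [|a' l' r'] //= [/hI-> /IHl-> /IHr->].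
Qed.

Lemma fmap_id_in (T : eqType) (h : T -> T) (F : forest T) :
  {in labs F, h =1 id} -> fmap h F = F.
Proof.
elim: F => //= a l IHl r IHr hid; rewrite hid ?mem_head// IHl ?IHr//.
  by move=> b bl; apply: hid; rewrite inE mem_cat bl !orbT.
by move=> b bl; apply: hid; rewrite inE mem_cat bl !orbT.
Qed.

Lemma map_fmap_ins (T U : Type) (h : T -> U) x (F : forest T) :
  map (fmap h) (ins x F) = ins (h x) (fmap h F).
Proof.
elim: F => //= a l IHl r IHr; rewrite -IHl -IHr map_cat -!map_comp.
by congr (_ :: _ ++ _); apply: eq_map => F.
Qed.

(** * Increasing labellings generated by insertions *)

Section Increasing.
Implicit Types F l r : forest nat.

Fixpoint incr (q : nat) F : bool :=
  if F is FCons a l r then [&& (q < a)%N, incr a l & incr q r] else true.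

(** Meant as the inverse of [ins m]: there [m] labels a leaf, so the discarded child forest is
    empty. *)
Fixpoint fdel (m : nat) F : forest nat :=
  if F is FCons a l r then
    if a == m then r else FCons a (fdel m l) (fdel m r)
  else FNil.

Definition grow (m : nat) : seq (forest nat) :=
  iteri m (fun i S => flatten (map (ins i.+1) S)) [:: FNil].

Lemma growS m : grow m.+1 = flatten (map (ins m.+1) (grow m)).
Proof. by []. Qed.

Lemma incr_labs q F v : incr q F -> v \in labs F -> (q < v)%N.
Proof.
elim: F q => //= a l IHl r IHr q /and3P[qa il ir].
rewrite inE mem_cat => /or3P[/eqP->//|/(IHl _ il)|/(IHr _ ir)//].
exact: ltn_trans.
Qed.

Lemma incr_kids q F u v : incr q F -> v \in kids F u -> (u < v)%N.
Proof.
elim: F q => //= a l IHl r IHr q /and3P[qa il ir].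
rewrite !mem_cat => /or3P[|/(IHl _ il)//|/(IHr _ ir)//].
by case: eqP => // -> /tops_labs; apply: incr_labs.
Qed.

Lemma perm_labs_ins (T : eqType) (x : T) (F F' : forest T) :
  F' \in ins x F -> perm_eq (labs F') (x :: labs F).
Proof.
elim: F F' => [|a l IHl r IHr] F' /=.
  by rewrite inE => /eqP->.
rewrite inE mem_cat => /or3P[/eqP->//|/mapP[l' l'l ->]|/mapP[r' r'r ->]] /=.
  apply: (@perm_trans _ (a :: (x :: labs l) ++ labs r)).
    by rewrite perm_cons perm_cat2r IHl.
  by apply/permP => p /=; lia.
apply: (@perm_trans _ (a :: labs l ++ (x :: labs r))).
  by rewrite perm_cons perm_cat2l IHr.
by apply/permP => p /=; rewrite !count_cat /=; lia.
Qed.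

Lemma incr_ins q m F F' : incr q F -> (q < m)%N -> all (gtn m) (labs F) ->
  F' \in ins m F -> incr q F'.
Proof.
elim: F q F' => [|a l IHl r IHr] q F' /=.
  by rewrite inE => _ qm _ /eqP-> /=; rewrite qm.
move=> /and3P[qa il ir] qm; rewrite all_cat => /and3P[am al ar].
rewrite inE mem_cat => /or3P[/eqP->|/mapP[l' l'l ->]|/mapP[r' r'r ->]] /=.
- by rewrite qm qa il ir.
- by rewrite qa ir (IHl a l').
- by rewrite qa il (IHr q r').
Qed.

Lemma incr_fdel q m F : incr q F -> incr q (fdel m F).
Proof.
elim: F q => //= a l IHl r IHr q /and3P[qa il ir].
by case: eqP => //= _; rewrite qa IHl// IHr.
Qed.

Lemma fdel_notin m F : m \notin labs F -> fdel m F = F.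
Proof.
elim: F => //= a l IHl r IHr; rewrite inE mem_cat !negb_or.
by rewrite eq_sym => /and3P[/negPf-> /IHl-> /IHr->].
Qed.

Lemma fdel_ins m F F' : m \notin labs F -> F' \in ins m F -> fdel m F' = F.
Proof.
elim: F F' => [|a l IHl r IHr] F' /=.
  by rewrite inE => _ /eqP-> /=; rewrite eqxx.
rewrite inE mem_cat !negb_or eq_sym => /and3P[am ml mr].
rewrite inE mem_cat => /or3P[/eqP->|/mapP[l' l'l ->]|/mapP[r' r'r ->]] /=.
- by rewrite eqxx.
- by rewrite (negPf am) (IHl l')// (fdel_notin mr).
- by rewrite (negPf am) (IHr r')// (fdel_notin ml).
Qed.

(** Labels increase downwards, so the largest one sits on a leaf, and reinserting it at the corner
    it occupied restores [F]. *)
Lemma mem_ins_fdel q m F : incr q F -> uniq (labs F) ->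
  all (geq m) (labs F) -> m \in labs F -> F \in ins m (fdel m F).
Proof.
elim: F q => //= a l IHl r IHr q /and3P[qa il ir].
rewrite mem_cat negb_or cat_uniq all_cat -!andbA.
move=> /and5P[al ar ul /hasPn lr ur] /and3P[ma ml mr].
have [am _|am] := eqVneq a m.
  suff -> : l = FNil by rewrite am ins_head mem_head.
  case: l il ml {IHl al ul lr} => //= b k k' /andP[ab _] /andP[bm _].
  by move: ab bm; rewrite am; lia.
rewrite inE eq_sym (negPf am) mem_cat /= => /orP[mil|mir].
  have mr' : m \notin labs r by apply/negP => /lr; rewrite /= mil.
  rewrite inE mem_cat; apply/or3P; apply: Or32.
  by rewrite (fdel_notin mr') map_f// (IHl a).
have ml' : m \notin labs l by have := lr m mir.
rewrite inE mem_cat; apply/or3P; apply: Or33.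
by rewrite (fdel_notin ml') map_f// (IHr q).
Qed.

Lemma mem_grow m F : (F \in grow m) = incr 0 F && perm_eq (labs F) (iota 1 m).
Proof.
elim: m F => [|m IHm] F.
  rewrite inE; apply/eqP/andP => [->//|[_]].
  by case: F => // a l r /perm_size.
have pm : perm_eq (iota 1 m.+1) (m.+1 :: iota 1 m).
  by have := iotaD 1 m 1; rewrite addn1 add1n => ->; rewrite (perm_catC _ [:: _]).
rewrite growS; apply/flatten_mapP/andP => [[G]|[iF pF]].
  rewrite IHm => /andP[iG pG] FG; split.
    apply: (incr_ins iG _ _ FG) => //; apply/allP => v.
    by rewrite (perm_mem pG) mem_iota add1n => /andP[].
  rewrite (perm_trans (perm_labs_ins FG))// perm_sym (perm_trans pm)//.
  by rewrite perm_cons perm_sym.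
have uF : uniq (labs F) by rewrite (perm_uniq pF) iota_uniq.
have FG : F \in ins m.+1 (fdel m.+1 F).
  apply: mem_ins_fdel iF _ _ _ => //; last first.
    by rewrite (perm_mem pF) mem_iota; lia.
  by apply/allP => v; rewrite (perm_mem pF) mem_iota /=; lia.
exists (fdel m.+1 F) => //; rewrite IHm incr_fdel//=.
rewrite -(perm_cons m.+1) -(permPl (perm_labs_ins FG)) (perm_trans pF)//.
Qed.

Lemma uniq_ins (T : eqType) (x : T) (F : forest T) :
  x \notin labs F -> uniq (ins x F).
Proof.
elim: F => //= a l IHl r IHr; rewrite inE mem_cat !negb_or => /and3P[xa xl xr].
rewrite mem_cat negb_or cat_uniq !map_inj_uniq ?IHl ?IHr//=; last 2 first.
- by move=> F F' [].
- by move=> F F' [].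
rewrite andbT -andbA; apply/and3P; split.
- by apply/mapP => -[l' _ [e _]]; rewrite e eqxx in xa.
- by apply/mapP => -[l' _ [e _]]; rewrite e eqxx in xa.
(* An insertion in [l] keeps [r], while one in [r] increases its size, so the two lists are
   disjoint. *)
- apply/hasPn => G /mapP[r' r'r ->] /=; apply/mapP => -[l' l'l [_ er]].
  by have := fsize_ins r'r; rewrite er; lia.
Qed.

Lemma uniq_flatten_map (I J : eqType) (f : I -> seq J) (s : seq I) :
  uniq s -> {in s, forall x, uniq (f x)} ->
  {in s &, forall x y z, z \in f x -> z \in f y -> x = y} ->
  uniq (flatten (map f s)).
Proof.
elim: s => //= x s IHs /andP[xs us] uf fI; rewrite cat_uniq uf ?mem_head//=.
rewrite IHs// ?andbT; last 2 first.
- by move=> y ys; apply: uf; rewrite inE ys orbT.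
- by move=> y z ys zs; apply: fI; rewrite inE ?ys ?zs orbT.
apply/hasPn => z /flatten_mapP[y ys zy]; apply: contra xs => /= zx.
by rewrite (fI x y _ _ z)// ?mem_head// inE ys orbT.
Qed.

(** Deleting the newest label recovers the forest before the insertion, so different forests have
    disjoint lists of successors. *)
Lemma uniq_grow m : uniq (grow m).
Proof.
elim: m => // m IHm; rewrite growS.
have notin F : F \in grow m -> m.+1 \notin labs F.
  by rewrite mem_grow => /andP[_ pF]; rewrite (perm_mem pF) mem_iota; lia.
apply: uniq_flatten_map => // [F Fm|F G Fm Gm H HF HG].
  by apply: uniq_ins; apply: notin.
by rewrite -(fdel_ins (notin _ Fm) HF) (fdel_ins (notin _ Gm) HG).
Qed.

Lemma map_fmap_grow m : map (fmap (fun=> tt)) (grow m) = shapes m.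
Proof.
elim: m => // m IHm; rewrite growS /= -IHm map_flatten -!map_comp.
by congr flatten; apply: eq_map => F /=; rewrite map_fmap_ins.
Qed.

End Increasing.

(** * Children lists and ranks in a tree *)

Section PitOrder.
Variables (n : nat) (t : pit n).

Definition ple (u v : 'I_n) : bool := (u == v) || ((u, v) \in (pit_val t).2).

Definition children (a : 'I_n) : seq 'I_n :=
  sort ple [seq v <- enum 'I_n | parent t v == Some a].

Lemma pit_rootE v : (parent t v == None) = (v == 0%N :> nat).
Proof.
by rewrite /parent; case: t => -[p s] /= /and5P[/forallP/(_ v)/eqP].
Qed.

Lemma pit_sibling u v :
  (u, v) \in (pit_val t).2 -> u != v /\ parent t u = parent t v.
Proof.
rewrite /parent; case: t => -[p s] /= /and5P[_ _ /forallP/(_ u)/forallP/(_ v) H _ _].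
by move=> uv; move: H; rewrite uv /= => /andP[? /eqP].
Qed.

Lemma ple_trans : transitive ple.
Proof.
rewrite /ple => v u w; case: t => -[p s] /= /and5P[_ _ _ H _].
case: eqP => [->//|_] /=; case: eqP => [->|_] /=; first by move->; rewrite orbT.
move=> uv vw; move/forallP/(_ u)/forallP/(_ v)/forallP/(_ w): H.
by rewrite uv vw /= => ->; rewrite orbT.
Qed.

Lemma ple_anti : antisymmetric ple.
Proof.
move=> u v /andP[uv vu]; apply/eqP; apply/negPn/negP => nuv.
move: uv vu; rewrite /ple (negPf nuv) eq_sym (negPf nuv) /= => uv vu.
have := ple_trans (y := v) (x := u) (z := u); rewrite /ple uv vu !orbT.
case: t uv vu => -[p s] /= /and5P[_ _ H3 H4 _] uv vu _.
have uu : (u, u) \in s.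
  by move/forallP/(_ u)/forallP/(_ v)/forallP/(_ u): H4; rewrite uv vu.
by move/forallP/(_ u)/forallP/(_ u): H3; rewrite uu eqxx.
Qed.

Lemma ple_total u v : parent t u = parent t v -> ple u v || ple v u.
Proof.
rewrite /parent /ple; case: t => -[p s] /= /and5P[_ _ _ _ H] puv.
have [->//|nuv] := eqVneq u v.
by move/forallP/(_ u)/forallP/(_ v): H; rewrite nuv puv eqxx.
Qed.

Lemma mem_children a v : (v \in children a) = (parent t v == Some a).
Proof. by rewrite mem_sort mem_filter mem_enum andbT. Qed.

Lemma children_uniq a : uniq (children a).
Proof. by rewrite sort_uniq filter_uniq// enum_uniq. Qed.

Lemma children_sorted a : sorted ple (children a).
Proof.
apply: (@sort_sorted_in _ (fun v => parent t v == Some a)).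
  by move=> u v /eqP pu /eqP pv; apply: ple_total; rewrite pu pv.
by rewrite filter_all.
Qed.

Lemma children_gt a v : v \in children a -> (a < v)%N.
Proof. by rewrite mem_children => /edge_lt. Qed.

Lemma children_eq a (s : seq 'I_n) : uniq s -> sorted ple s ->
  (forall v, (v \in s) = (parent t v == Some a)) -> children a = s.
Proof.
move=> us ss ms; apply: (sorted_eq ple_trans ple_anti) => //.
  exact: children_sorted.
by apply: uniq_perm => // [|v]; rewrite ?children_uniq// mem_children ms.
Qed.

Lemma leaf_path0 v : leaf_path t v 0 = (children v == [::]).
Proof.
have -> : leaf_path t v 0 = leaf t v.
  apply/existsP/idP => [[p]|lv]; first by rewrite (tuple0 p).
  by exists [tuple].
apply/forallP/eqP => [H|H u].
  case E: (children v) => [//|u s].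
  by have := H u; rewrite /edge -mem_children E mem_head.
by rewrite /edge -mem_children H.
Qed.

Lemma leaf_pathS v j :
  leaf_path t v j.+1 = has (fun u => leaf_path t u j) (children v).
Proof.
apply/existsP/hasP => [[p]|[u]].
  case/tupleP: p => u p /= /andP[/andP[vu up] lp]; exists u.
    by rewrite mem_children.
  by apply/existsP; exists p; rewrite up.
rewrite mem_children => vu /existsP[p /andP[up lp]].
by exists [tuple of u :: p]; rewrite /= /edge vu up.
Qed.

Lemma leafdist_tops F j : fits children F ->
  leafdist F j = has (fun u => leaf_path t u j) (tops F).
Proof.
elim: F j => // a l IHl r IHr j /= /and3P[/eqP tl fl fr].
rewrite IHr//; congr (_ || _).
by case: j => [|j]; rewrite ?leaf_path0 ?leaf_pathS -tl ?IHl//; case: (l).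
Qed.

Lemma has_rankE a l k : fits children l -> tops l = children a ->
  has_rank k l = (rank t a == k).
Proof.
move=> fl tl.
have lE j : lpath l j = leaf_path t a j.
  case: j => [|j] /=; rewrite ?leaf_path0 ?leaf_pathS -tl ?leafdist_tops//.
  by case: (l).
rewrite /has_rank lE /rank; case: ex_minnP => i pi imin.
apply/andP/eqP => [[pk /forallP nk]|<-]; last first.
  split=> //; apply/forallP => j; rewrite lE; apply/negP => /imin.
  by rewrite leqNgt ltn_ord.
apply/eqP; rewrite eqn_leq imin//= leqNgt; apply/negP => ik.
by have := nk (Ordinal ik); rewrite lE /= pi.
Qed.

Lemma nodesum_count (R : realFieldType) k F : fits children F ->
  nodesum (rank_ind R k) F = (count (fun v => rank t v == k) (labs F))%:R.
Proof.
elim: F => //= a l IHl r IHr /and3P[/eqP tl fl fr].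
by rewrite IHl// IHr// /rank_ind (has_rankE k fl tl) count_cat !natrD addrA.
Qed.

Fixpoint unfold (fuel : nat) (a : 'I_n) : forest 'I_n :=
  if fuel is f.+1 then
    foldr (fun u F => FCons u (unfold f u) F) FNil (children a)
  else FNil.

(** Labels increase along edges, so [n - a] levels exhaust the descendants of [a]. *)
Lemma unfoldP fuel (a : 'I_n) : (n - a <= fuel)%N ->
  tops (unfold fuel a) = children a /\ fits children (unfold fuel a).
Proof.
elim: fuel a => [|fuel IH] a /=; first by have := ltn_ord a; lia.
move=> an.
have : all (fun u : 'I_n => (a < u)%N) (children a) by apply/allP => u /children_gt.
elim: (children a) => //= u s IHs /andP[au] /IHs[-> ->]; split=> //.
by have [|-> ->] := IH u; [have := ltn_ord u; lia|rewrite eqxx].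
Qed.

End PitOrder.

(** * Trees built from children lists *)

Section PitOf.
Variables (n : nat) (K : 'I_n -> seq 'I_n).
Hypothesis K_lt : forall u v, v \in K u -> (u < v)%N.
Hypothesis K_uniq : forall u, uniq (K u).
Hypothesis K_inj : forall u u' v, v \in K u -> v \in K u' -> u = u'.
Hypothesis K_ex : forall v : 'I_n, v != 0%N :> nat -> exists u, v \in K u.

Definition pit_of_val : {ffun 'I_n -> option 'I_n} * {set 'I_n * 'I_n} :=
  ([ffun v => [pick u | v \in K u]],
   [set uv | [exists q, [&& uv.1 \in K q, uv.2 \in K q &
                           (index uv.1 (K q) < index uv.2 (K q))%N]]]).

Lemma pit_of_parent v u : (pit_of_val.1 v == Some u) = (v \in K u).
Proof.
rewrite ffunE; case: pickP => [u' vu'|nu].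
  by apply/eqP/idP => [[<-]//|vu]; rewrite (K_inj vu vu').
by rewrite (nu u).
Qed.

Lemma pit_of_sib u v : reflect
  (exists q, [/\ u \in K q, v \in K q & (index u (K q) < index v (K q))%N])
  ((u, v) \in pit_of_val.2).
Proof.
rewrite inE; apply: (iffP existsP) => [[q /and3P[]]|[q []]] *; exists q => //.
exact/and3P.
Qed.

Lemma pit_ofP : is_pit pit_of_val.
Proof.
rewrite /is_pit -[pit_of_val]/(pit_of_val.1, pit_of_val.2).
have par v u : v \in K u -> pit_of_val.1 v = Some u.
  by move=> vu; apply/eqP; rewrite pit_of_parent.
have root v : (pit_of_val.1 v == None) = (v == 0%N :> nat).
  have [v0|v0] := eqVneq (v : nat) 0%N.
    rewrite ffunE; case: pickP => // u /K_lt; by rewrite v0.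
  by have [u /par->] := K_ex v0.
apply/and5P; split.
- by apply/forallP => v; rewrite root eqxx.
- apply/forallP => v; apply/forallP => u; rewrite pit_of_parent.
  exact/implyP/K_lt.
- apply/forallP => u; apply/forallP => v; apply/implyP => /pit_of_sib[q [uq vq ltuv]].
  rewrite (par _ _ uq) (par _ _ vq) eqxx andbT.
  by apply: contraTneq ltuv => ->; rewrite ltnn.
- apply/forallP => u; apply/forallP => v; apply/forallP => w.
  apply/implyP => /andP[/pit_of_sib[q [uq vq ltuv]] /pit_of_sib[q' [vq' wq' ltvw]]].
  have eq := K_inj vq vq'; subst q'.
  by apply/pit_of_sib; exists q; split=> //; apply: ltn_trans ltvw.
- apply/forallP => u; apply/forallP => v; apply/implyP => /andP[nuv puv].
  have [|u0] := boolP (pit_of_val.1 u == None).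
    move=> u0; move: (u0); rewrite (eqP puv) root => /eqP v0.
    move: u0; rewrite root => /eqP u0.
    by case/eqP: nuv; apply: val_inj; rewrite /= u0 v0.
  move: u0; rewrite root => /K_ex[q uq].
  have vq : v \in K q by rewrite -pit_of_parent -(eqP puv) pit_of_parent.
  have [ltuv|ltvu|euv] := ltngtP (index u (K q)) (index v (K q)).
  + by apply/orP; left; apply/pit_of_sib; exists q.
  + by apply/orP; right; apply/pit_of_sib; exists q.
  + by case/eqP: nuv; rewrite -(nth_index u uq) euv nth_index.
Qed.

Definition pit_of : pit n := Pit pit_ofP.

Lemma children_pit_of a : children pit_of a = K a.
Proof.
apply: children_eq => // [|v]; last by rewrite /parent pit_of_parent.
have [->//|] := eqVneq (K a) [::]; case E: (K a) => [//|x s] _; rewrite -E.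
apply/(sortedP x) => i iK; apply/orP; right; apply/pit_of_sib; exists a.
by have i'K := ltnW iK; split; rewrite ?mem_nth// !index_uniq.
Qed.

End PitOf.

(** * Bijection between trees and grown forests *)

Section Bijection.
Variable m : nat.
Implicit Types t : pit m.+1.

Definition child_forest t : forest 'I_m.+1 := unfold t m.+1 ord0.

Definition shape_of t : forest unit := fmap (fun=> tt) (child_forest t).

Lemma child_forestP t :
  tops (child_forest t) = children t ord0 /\ fits (children t) (child_forest t).
Proof. by apply: unfoldP; rewrite subn0. Qed.

Lemma child_forest_fits t : fits (children t) (FCons ord0 (child_forest t) FNil).
Proof. by have [tF fF] := child_forestP t; rewrite /= tF eqxx fF. Qed.

Lemma perm_labs_child_forest t :
  perm_eq (labs (FCons ord0 (child_forest t) FNil)) (enum 'I_m.+1).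
Proof.
have fF := child_forest_fits t; set F := FCons _ _ _ in fF *.
suff H v : count_mem v (labs F) = 1%N.
  apply/allP => v _; apply/eqP.
  by rewrite H count_uniq_mem ?enum_uniq// mem_enum.
(* Strong induction on the label: by [count_labs], a vertex other than the root occurs as often as
   its parent, whose label is smaller, and the root occurs once. *)
have [k] := ubnP (v : nat); elim: k v => // k IH v; rewrite ltnS => vk.
rewrite (count_labs v fF) /= addn0.
have cE a : count_mem v (children t a) = (parent t v == Some a).
  by rewrite count_uniq_mem ?children_uniq// mem_children.
under eq_bigr do rewrite cE.
case E: (parent t v) => [u|].
  have uv : (u < v)%N by apply: (@edge_lt _ t); rewrite /edge E.
  have -> : (ord0 == v) = false by apply/eqP => e; rewrite -e in uv.
  rewrite add0n -(IH u); last by rewrite (leq_trans uv).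
  by rewrite -sum1_count [RHS]big_mkcond /=; apply: eq_bigr => a _;
    rewrite -[Some u == Some a]/(u == a) eq_sym; case: (a == u).
rewrite big1//=.
have := pit_rootE t v; rewrite E eqxx => /esym/eqP v0.
by rewrite (_ : ord0 == v)//; apply/eqP/val_inj.
Qed.

(** The forest determines all children lists, hence the parents; the order of siblings is recovered
    from their positions in these sorted lists. *)
Lemma child_forest_inj : injective child_forest.
Proof.
move=> t t' E.
have chE a : children t a = children t' a.
  have := child_forest_fits t'; rewrite -E => f'.
  apply: (fits_eq (child_forest_fits t) f').
  by rewrite (perm_mem (perm_labs_child_forest t)) mem_enum.
have pE v : parent t v = parent t' v.
  case Et: (parent t v) => [u|]; apply/esym/eqP.
    by rewrite -mem_children -chE mem_children Et.
  by rewrite pit_rootE -(pit_rootE t) Et.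
have sub (s s' : pit m.+1) : (forall a, children s a = children s' a) ->
   forall u v, (u, v) \in (pit_val s).2 -> (u, v) \in (pit_val s').2.
  move=> ssE u v uv; have [nuv puv] := pit_sibling uv.
  have [|pu] := eqVneq (parent s u) None.
    move=> pu; have := pu; rewrite puv => /eqP; rewrite pit_rootE => /eqP v0.
    move/eqP: pu; rewrite pit_rootE => /eqP u0.
    by case/eqP: nuv; apply: val_inj; rewrite /= u0 v0.
  case Eu: (parent s u) pu => [q|//] _.
  have uq : u \in children s q by rewrite mem_children Eu.
  have vq : v \in children s q by rewrite mem_children -puv Eu.
  suff : ple s' u v by rewrite /ple (negPf nuv).
  have lesr w : ple s' w w by rewrite /ple eqxx.
  have [lei|lti] := leqP (index u (children s q)) (index v (children s q)).
    move: (uq) (vq) lei; rewrite ssE => uq' vq' lei.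
    exact: (sorted_leq_index (@ple_trans _ s') lesr (children_sorted s' q)).
  have vu : ple s v u.
    have lesr' w : ple s w w by rewrite /ple eqxx.
    exact: (sorted_leq_index (@ple_trans _ s) lesr' (children_sorted s q) v u vq uq (ltnW lti)).
  case/eqP: nuv; apply: (@ple_anti _ s); by rewrite vu /ple uv orbT.
apply: val_inj; rewrite [LHS]surjective_pairing [RHS]surjective_pairing.
congr (_, _); first by apply/ffunP => v; apply: pE.
by apply/setP => -[u v]; apply/idP/idP; apply: sub.
Qed.

Lemma incr_child_forest t (q : nat) F : fits (children t) F ->
  {in tops F, forall v : 'I_m.+1, (q < v)%N} -> incr q (fmap val F).
Proof.
elim: F q => //= a l IHl r IHr q /and3P[/eqP tl fl fr] qF.
rewrite qF ?mem_head//= IHl ?IHr//.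
  by move=> v vr; apply: qF; rewrite inE vr orbT.
by move=> v; rewrite tl => /children_gt.
Qed.

Lemma child_forest_grow t : fmap val (child_forest t) \in grow m.
Proof.
have [tF fF] := child_forestP t.
rewrite mem_grow (@incr_child_forest t)//=; last first.
  by move=> v; rewrite tF => /children_gt.
rewrite labs_fmap.
have := perm_map val (perm_labs_child_forest t).
by rewrite val_enum_ord /= cats0 perm_cons.
Qed.

Lemma child_forest_surj F : F \in grow m ->
  exists t, fmap val (child_forest t) = F.
Proof.
rewrite mem_grow => /andP[iF pF].
pose G := fmap (@inord m) F.
have GF : fmap val G = F.
  rewrite fmap_comp; apply: fmap_id_in => v; rewrite (perm_mem pF) mem_iota.
  by move=> vm; rewrite /= inordK//; lia.
pose H := FCons ord0 G FNil.
have pH : perm_eq (labs H) (enum 'I_m.+1).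
  apply: (perm_map_inj val_inj); rewrite val_enum_ord /= cats0 perm_cons.
  by rewrite -labs_fmap GF.
have uH : uniq (labs H) by rewrite (perm_uniq pH) enum_uniq.
pose K := kids H.
have fH : fits (K) H by apply: fits_kids.
(* Each vertex is the root or occurs once in a single children list; [K_uniq], [K_inj] and [K_ex]
   all follow from this count. *)
have cnt v : ((v == ord0) + \sum_(a : 'I_m.+1) count_mem v (K a) = 1)%N.
  have := count_labs v fH; rewrite (perm_big _ pH) /= big_enum /= addn0 eq_sym => <-.
  have /permP/(_ (pred1 v)) := pH.
  by rewrite [RHS]count_uniq_mem ?enum_uniq// mem_enum /= (eq_sym v).
have kids_fmap (I : forest 'I_m.+1) u v :
    v \in kids I u -> val v \in kids (fmap val I) (val u).
  elim: I => //= a l IHl r IHr; rewrite !mem_cat => /or3P[|/IHl->|/IHr->]; rewrite ?orbT//.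
  case: eqP => // -> vl; rewrite eqxx; apply/orP; left.
  elim: (l) vl => //= b k _ k' IH; rewrite !inE => /orP[/eqP->|/IH->]; rewrite ?eqxx ?orbT//.
have K_lt u v : v \in K u -> (u < v)%N.
  move=> /kids_fmap; rewrite /= GF cats0 mem_cat => /orP[|/(incr_kids iF)//].
  by case: eqP => // -> /tops_labs /(incr_labs iF).
have le1 u v : (count_mem v (K u) <= 1)%N.
  by have := cnt v; rewrite (bigD1 u) //=; lia.
have K_uniq u : uniq (K u).
  apply: count_mem_uniq => v; have := le1 u v; have := has_pred1 v (K u).
  by rewrite has_count; case: (count_mem _ _) => [|[]] //=; case: (_ \in _).
have K_inj u u' v : v \in K u -> v \in K u' -> u = u'.
  move=> vu vu'; apply/eqP/negPn/negP => nu; have := cnt v.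
  rewrite (bigD1 u) //= (bigD1 u') /= ?[u' == _]eq_sym//.
  move: vu vu'; rewrite -!has_pred1 !has_count.
  by case: (count_mem v (K u)) => // x; case: (count_mem v (K u')) => // y; lia.
have K_ex (v : 'I_m.+1) : v != 0%N :> nat -> exists u, v \in K u.
  move=> v0; have := cnt v; rewrite (_ : (v == ord0) = false) ?add0n; last first.
    by apply/eqP => e; rewrite e in v0.
  move=> S1; have : (0 < \sum_(a : 'I_m.+1) count_mem v (K a))%N by rewrite S1.
  rewrite lt0n sum_nat_eq0 negb_forall => /existsP[u]; rewrite negb_imply /= => cu.
  by exists u; rewrite -has_pred1 has_count lt0n.
pose t := pit_of K_lt K_inj K_ex; exists t.
rewrite -GF; congr fmap.
have [tF fF] := child_forestP t.
have chE := children_pit_of K_lt K_uniq K_inj K_ex.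
move: fH => /= /and3P[/eqP tG fG _].
apply: (fits_inj fF).
  by rewrite (_ : children t = K)//; apply: funext => a; apply: chE.
by rewrite tF chE tG.
Qed.

(** Labelled child forests are in bijection with the duplicate-free list [grow m]; erasing labels
    turns this into an equality of multisets. *)
Lemma perm_shapes : perm_eq (map shape_of (enum {: pit m.+1})) (shapes m).
Proof.
rewrite -map_fmap_grow.
have -> : map shape_of (enum {: pit m.+1}) =
    map (fmap (fun=> tt)) (map (fun t => fmap val (child_forest t)) (enum {: pit m.+1})).
  by rewrite -map_comp; apply: eq_map => t; rewrite /= fmap_comp.
apply: perm_map; apply: uniq_perm.
- rewrite map_inj_uniq ?enum_uniq// => t t' /fmap_inj H.
  exact/child_forest_inj/H/val_inj.
- exact: uniq_grow.
- move=> F; apply/mapP/idP => [[t _ ->]|/child_forest_surj[t <-]].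
    exact: child_forest_grow.
  by exists t => //; rewrite mem_enum.
Qed.

Lemma sum_pit (R : realFieldType) (f : forest unit -> R) :
  \sum_(t : pit m.+1) f (shape_of t) = shape_sum m f.
Proof. by rewrite /shape_sum -(perm_big _ perm_shapes) /= big_map big_enum. Qed.

Lemma card_pit : #|{: pit m.+1}| = size (shapes m).
Proof. by rewrite -(perm_size perm_shapes) size_map -cardE. Qed.

Lemma leafdist_fmap (T U : Type) (h : T -> U) (F : forest T) j :
  leafdist (fmap h F) j = leafdist F j.
Proof.
elim: F j => //= a l IHl r IHr [|j]; rewrite ?IHl IHr//.
by case: (l).
Qed.

Lemma has_rank_fmap (T U : Type) (h : T -> U) k (F : forest T) :
  has_rank k (fmap h F) = has_rank k F.
Proof.
have lE j : lpath (fmap h F) j = lpath F j.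
  by case: j => [|j] /=; [case: (F)|rewrite leafdist_fmap].
by rewrite /has_rank lE; congr (_ && _); apply: eq_forallb => i; rewrite lE.
Qed.

Lemma has_rank_shape k t : has_rank k (shape_of t) = (rank t ord0 == k).
Proof.
have [tF fF] := child_forestP t.
by rewrite has_rank_fmap (has_rankE k fF tF).
Qed.

Lemma rank_count_shape (R : realFieldType) k t :
  rank_count R k (shape_of t) = #|[set v | rank t v == k]|%:R.
Proof.
have -> : rank_count R k (shape_of t) = rank_count R k (child_forest t).
  rewrite /rank_count /rank_ind has_rank_fmap; congr (_ + _).
  rewrite /shape_of; elim: (child_forest t) => //= a l -> r ->.
  by rewrite has_rank_fmap.
have := nodesum_count R k (child_forest_fits t).
rewrite /= addr0 /rank_count => ->; congr (_%:R).
rewrite cardsE cardE size_filter -enumT.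
by rewrite -(permP (perm_labs_child_forest t)) /= cats0.
Qed.

Lemma b_shapes (R : realFieldType) k : (b k m.+1)%:R = shape_sum m (rank_ind R k).
Proof.
rewrite -sum_pit /b cardsE -sum1_card big_mkcond natr_sum /=; apply: eq_bigr => t _.
rewrite /rank_ind has_rank_shape.
suff e : [exists v, is_root t v && (rank t v == k)] = (rank t ord0 == k).
  by rewrite unfold_in /= e; case: (_ == _).
apply/existsP/idP => [[v /andP[rv]]|r0].
  have -> // : v = ord0 by apply: val_inj; apply/eqP; rewrite /= -(pit_rootE t).
by exists ord0; rewrite r0 andbT /is_root pit_rootE.
Qed.

End Bijection.

(** * Tuples of distinct vertices *)

Lemma expn_le_ffact (n r : nat) : (n * n ^ r <= n * n ^_ r + r ^ 2 * n ^ r)%N.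
Proof.
elim: r => [|r IHr]; first by rewrite ffactn0 expn0 leq_addr.
rewrite ffactnSr !expnS.
have h : (n ^_ r <= n ^ r)%N.
  by elim: (r) => // r' IH; rewrite ffactnSr expnS mulnC leq_mul// leq_subr.
(* This rests on [n <= (n - r) + r], valid also when the subtraction truncates. The induction then
   closes by [r ^ 2 + r <= r.+1 ^ 2]. *)
have h2 : (n * n ^_ r <= n ^_ r * (n - r) + r * n ^ r)%N.
  have rh : (r * n ^_ r <= r * n ^ r)%N by rewrite leq_mul.
  have : (n * n ^_ r <= n ^_ r * (n - r) + r * n ^_ r)%N.
    by rewrite (mulnC r) -mulnDr mulnC leq_mul//; lia.
  by move=> /leq_trans; apply; rewrite leq_add2l.
move: (n ^ r)%N (n ^_ r)%N (n ^_ r * (n - r))%N IHr h2 => x y z IHr h2.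
nia.
Qed.

Section Tuples.
Variables (n r : nat) (k : r.-tuple nat) (t : pit n).

Let N (i : 'I_r) : nat := #|[set v | rank t v == tnth k i]|.

Lemma card_rank_tuples :
  #|[set v : r.-tuple 'I_n | [forall i, rank t (tnth v i) == tnth k i]]| =
    (\prod_(i < r) N i)%N.
Proof.
have -> : (\prod_(i < r) N i = \prod_(i < r) \sum_(v : 'I_n) (rank t v == tnth k i))%N.
  apply: eq_bigr => i _; rewrite /N -sum1dep_card big_mkcond /=.
  by apply: eq_bigr => v _; case: (_ == _).
rewrite bigA_distr_bigA /=.
rewrite -sum1dep_card big_mkcond /=.
rewrite (reindex (fun f : {ffun 'I_r -> 'I_n} => [tuple f i | i < r])) /=.
  apply: eq_bigr => f _; 
  case: forallP => [H|H].
    by rewrite big1// => i _; have := H i; rewrite tnth_mktuple => ->.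
  apply/esym/eqP; rewrite -leqn0 leqNgt; apply/negP => P0; apply: H => i.
  rewrite tnth_mktuple; apply/negPn/negP => ni.
  by move: P0; rewrite (bigD1 i)//= (negPf ni) mul0n.
exists (fun v : r.-tuple 'I_n => [ffun i => tnth v i]) => [f _|v _].
  by apply/ffunP => i; rewrite ffunE tnth_mktuple.
by apply: eq_from_tnth => i; rewrite tnth_mktuple ffunE.
Qed.

Lemma X_le_prod : (X k t <= \prod_(i < r) N i)%N.
Proof.
by rewrite -card_rank_tuples subset_leq_card//; apply/fintype.subsetP => v; rewrite !inE => /andP[].
Qed.

(** Every tuple lost to distinctness has a repeated vertex, and a proportion of at most [r ^ 2 / n]
    of all tuples does. *)
Lemma prod_le_X : (n * \prod_(i < r) N i <= n * X k t + r ^ 2 * n ^ r)%N.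
Proof.
have cu : #|[set v : r.-tuple 'I_n | uniq v]| = (n ^_ r)%N.
  have := @card_uniq_tuples _ r (predT : pred 'I_n).
  rewrite cardT size_enum_ord => <-; apply: eq_card => v; rewrite !inE.
  by rewrite (_ : all _ _ = true)//; apply/allP.
(* Inclusion-exclusion for the tuples of prescribed ranks and the tuples of distinct vertices, whose
   union has at most [n ^ r] elements. *)
have H : (\prod_(i < r) N i + n ^_ r <= X k t + n ^ r)%N.
  rewrite -card_rank_tuples -cu -cardsUI addnC leq_add//.
    by rewrite subset_leq_card//; apply/fintype.subsetP => v; rewrite !inE andbC.
  by rewrite (leq_trans (max_card _))// card_tuple card_ord.
have := expn_le_ffact n r.
move: (\prod_(i < r) N i)%N (n ^_ r)%N (X k t) (n ^ r)%N H => p f x e H.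
nia.
Qed.

End Tuples.

Local Open Scope classical_set_scope.
Local Open Scope ring_scope.

(** * The constants *)

Section BetaIntegral.
Variable R : realType.
Local Notation mu := (@lebesgue_measure R).

Let s (x : R) : R := Num.sqrt (1 - 2 * x).

Let s_continuous : continuous s.
Proof.
move=> x; rewrite /s; apply: (@continuous_comp _ _ _ (fun x : R => 1 - 2 * x)).
  by apply: cvgB; [exact: cvg_cst|apply: cvgM; [exact: cvg_cst|exact: cvg_id]].
exact: sqrt_continuous.
Qed.

(* From (x^m (1-2x)^(3/2))' = m x^(m-1) (1-2x)^(1/2) - (2m+3) x^m (1-2x)^(1/2),
   the primitive of x^m (1-2x)^(1/2) that vanishes at 1/2. *)
Fixpoint beta_prim (m : nat) (x : R) : R :=
  if m is m'.+1 then
    (m%:R * beta_prim m' x - x ^+ m * ((1 - 2 * x) * Num.sqrt (1 - 2 * x)))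
      / (2 * m%:R + 3)
  else - ((1 - 2 * x) * Num.sqrt (1 - 2 * x)) / 3.

Lemma beta_prim_continuous (m : nat) : continuous (beta_prim m).
Proof.
have c1 : continuous (fun x : R => (1 - 2 * x) * s x).
  move=> x; apply: cvgM; last exact: s_continuous.
  by apply: cvgB; [exact: cvg_cst|apply: cvgM; [exact: cvg_cst|exact: cvg_id]].
elim: m => [|m IHm] x.
  by apply: cvgM; [apply: cvgN; exact: c1|exact: cvg_cst].
apply: cvgM; last exact: cvg_cst.
apply: cvgB; first by apply: cvgM; [exact: cvg_cst|exact: IHm].
by apply: cvgM; [exact: exprn_continuous|exact: c1].
Qed.

Let dM (f g : R -> R) (x df dg : R) : is_derive x 1 f df -> is_derive x 1 g dg ->
  is_derive x 1 (fun x => f x * g x) (f x * dg + df * g x).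
Proof.
move=> hf hg; apply: (is_derive_eq (is_deriveM hf hg)).
by rewrite /GRing.scale /= [g x * _]mulrC.
Qed.

Let dB (f g : R -> R) (x df dg : R) : is_derive x 1 f df -> is_derive x 1 g dg ->
  is_derive x 1 (fun x => f x - g x) (df - dg).
Proof. by move=> hf hg; exact: is_deriveB. Qed.

Let dC (a x : R) : is_derive x 1 (fun=> a) 0.
Proof. exact: is_derive_cst. Qed.

Lemma is_derive_beta_prim (m : nat) (x : R) : x < 2^-1 ->
  is_derive x 1 (beta_prim m) (x ^+ m * s x).
Proof.
move=> xlt.
have y0 : 0 < 1 - 2 * x by lra.
have dlin : is_derive x 1 (fun x : R => 1 - 2 * x) (- 2).
  apply: (is_derive_eq (dB (dC 1 x) (dM (dC 2 x) (is_derive_id x 1)))).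
  by ring.
have ds : is_derive x 1 s (- (s x)^-1).
  have H := @is_derive1_comp _ Num.sqrt (fun x : R => 1 - 2 * x) x _ _ (is_derive1_sqrt y0) dlin.
  apply: (is_derive_eq H).
  by rewrite /s; field; rewrite gt_eqF// sqrtr_gt0.
have sx0 : s x != 0 by rewrite gt_eqF// sqrtr_gt0.
have ss : s x * s x = 1 - 2 * x by rewrite -expr2 sqr_sqrtr ?ltW.
have d1 : is_derive x 1 (fun x => (1 - 2 * x) * s x) (- 3 * s x).
  by apply: (is_derive_eq (dM dlin ds)); rewrite -ss; field.
have dX (n : nat) : is_derive x 1 (fun x : R => x ^+ n.+1) (n.+1%:R * x ^+ n).
  split; first exact: exprn_derivable.
  by rewrite exp_derive /GRing.scale /= mulr1.
have m0 (n : nat) : 2 * n%:R + 3 != 0 :> R by rewrite gt_eqF// ltr_wpDl// mulr_ge0.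
elim: m => [|m IHm].
  apply: (is_derive_eq (dM (is_deriveN d1) (dC 3^-1 x))).
  by rewrite /s /=; field.
apply: (is_derive_eq (dM (dB (dM (dC m.+1%:R x) IHm) (dM (dX m) d1)) (dC (2 * m.+1%:R + 3)^-1 x))).
rewrite -/(s x) exprS; have := m0 m.+1; move: m.+1%:R => M M0.
by field.
Qed.

(** The primitive is continuous everywhere and is differentiated only below 1/2, which suffices for
    the fundamental theorem on the closed interval. *)
Lemma integral_beta (m : nat) :
  (\int[mu]_(x in `[0%R, 2^-1%R]) (x ^+ m * s x)%:E = (- beta_prim m 0)%:E)%E.
Proof.
have h0 : (0 : R) < 2^-1 by rewrite invr_gt0.
have bm : beta_prim m 2^-1 = 0.
  have e0 : 1 - 2 * 2^-1 = 0 :> R by rewrite divff ?subrr.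
  elim: m => [|m IHm] /=; first by rewrite e0 !mul0r oppr0 mul0r.
  by rewrite IHm e0 !(mul0r, mulr0) subr0 mul0r.
rewrite (@continuous_FTC2 _ _ (beta_prim m))//.
- by rewrite bm sub0e.
- apply: continuous_subspaceT => x; apply: cvgM; last exact: s_continuous.
  exact: exprn_continuous.
- split.
  + move=> x; rewrite in_itv /= => /andP[_ xlt].
    by have [] := is_derive_beta_prim m xlt.
  + exact/cvg_at_right_filter/beta_prim_continuous.
  + exact/cvg_at_left_filter/beta_prim_continuous.
- move=> x; rewrite in_itv /= => /andP[_ xlt].
  have dx := is_derive_beta_prim m xlt.
  by rewrite derive1E (@derive_val _ _ _ _ _ _ _ dx).
Qed.

(** The beta integral times the coefficient [(2m-1)!!/m!] is exactly the weight in [mean_nodesum]: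
    from [m] to [m+1] both gain the factor [(2m+1)/(2m+5)]. *)
Lemma beta_prim0 (m : nat) :
  - beta_prim m 0 * ((size (shapes m))%:R / m`!%:R) =
    ((2 * m%:R + 1) * (2 * m%:R + 3))^-1.
Proof.
elim: m => [|m IHm].
  by rewrite /= fact0 mulr0 subr0 sqrtr1; field.
have m3 : 2 * m%:R + 3 != 0 :> R by rewrite gt_eqF// ltr_wpDl// mulr_ge0.
have m1 : 2 * m%:R + 1 != 0 :> R by rewrite gt_eqF// ltr_wpDl// mulr_ge0.
have m5 : 2 * m.+1%:R + 3 != 0 :> R by rewrite gt_eqF// ltr_wpDl// mulr_ge0.
have mf : m`!%:R != 0 :> R by rewrite pnatr_eq0 -lt0n fact_gt0.
have mS : m.+1%:R != 0 :> R by rewrite pnatr_eq0.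
have -> : - beta_prim m.+1 0 = m.+1%:R / (2 * m.+1%:R + 3) * - beta_prim m 0.
  by rewrite /= exprS !mul0r subr0; ring.
rewrite natr_size_shapesS factS natrM.
transitivity ((- beta_prim m 0 * ((size (shapes m))%:R / m`!%:R)) *
   ((2 * m%:R + 1) / (2 * m.+1%:R + 3))).
  by move: m.+1%:R mS m5 => M M0 M5; field; rewrite mf M0 M5.
rewrite IHm; move: m5; rewrite -(natr1 m) => m5.
have m3' : 2 * (m%:R + 1) + 1 != 0 :> R by rewrite natr1 gt_eqF// ltr_wpDl// mulr_ge0.
by field; rewrite ?m1 ?m3 ?m5 ?m3'.
Qed.

End BetaIntegral.

(** * Convergence of power series below 1/2 *)

Section PowerSeries.
Variable R : realType.

Lemma bernoulli_ineq (e : R) (n : nat) : 0 <= e -> 1 + n%:R * e <= (1 + e) ^+ n.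
Proof.
move=> e0; elim: n => [|n IHn]; first by rewrite mul0r addr0.
rewrite exprS -natr1 (le_trans _ (ler_wpM2l _ IHn))//; last by lra.
have : 0 <= n%:R * e * e by rewrite !mulr_ge0.
lra.
Qed.

Lemma is_cvg_pseries_lt_half (u : nat -> R) (C K : R) : 0 < K -> K < 2^-1 ->
  (forall n, 0 <= u n <= C * n.+1%:R * 2 ^+ n) -> cvgn (pseries u K).
Proof.
move=> K0 K1 uC.
have q0 : 0 < 2 * K by lra.
have q1 : 2 * K < 1 by lra.
(* [e] is chosen so that [q * (1 + e) = (1 + q) / 2 < 1]; by Bernoulli's inequality [(1 + e) ^+ n]
   absorbs the factor [n.+1]. *)
set q := 2 * K in q0 q1; pose e : R := (1 - q) / (2 * q).
have e0 : 0 < e by rewrite divr_gt0 ?mulr_gt0//; lra.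
have qe : q * (1 + e) = (1 + q) / 2 by rewrite /e; field; rewrite gt_eqF.
have C0 : 0 <= C by have := uC 0%N; rewrite expr0 !mulr1 => /andP[/le_trans]; apply.
apply: (@series_le_cvg _ _ (geometric (C * (1 + e^-1)) ((1 + q) / 2))) => [n|n|n|].
- by rewrite mulr_ge0 ?exprn_ge0 ?(ltW K0)//; have /andP[] := uC n.
- by rewrite /= !mulr_ge0 ?exprn_ge0// ?addr_ge0 ?invr_ge0 ?(ltW e0)//; lra.
- rewrite /= -qe exprMn.
  have -> : u n * K ^+ n <= C * (1 + e^-1) * (q ^+ n * (1 + e) ^+ n) =
      (u n * K ^+ n <= (C * ((1 + e^-1) * (1 + e) ^+ n) * 2 ^+ n) * K ^+ n).
    by rewrite /q exprMn; congr (_ <= _); ring.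
  rewrite ler_wpM2r ?exprn_ge0 ?(ltW K0)//.
  have /andP[_ /le_trans] := uC n; apply.
  rewrite ler_wpM2r ?exprn_ge0// ler_wpM2l//.
  apply: (@le_trans _ _ ((1 + e^-1) * (1 + n%:R * e))); last first.
    by rewrite ler_wpM2l ?bernoulli_ineq ?(ltW e0)// addr_ge0 ?invr_ge0 ?ltW.
  have -> : (1 + e^-1) * (1 + n%:R * e) = n.+1%:R + (n%:R * e + e^-1).
    by rewrite -(natr1 n); field; rewrite gt_eqF.
  have ne0 : 0 <= n%:R * e by rewrite mulr_ge0// ltW.
  by rewrite lerDl addr_ge0// invr_ge0 ltW.
- by apply: is_cvg_geometric_series; rewrite ger0_norm; lra.
Qed.

End PowerSeries.

(** A path, whose virtual root has rank [j]; it witnesses that rank [k] has positive probability at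
    size [k], hence that the constant is positive. *)
Fixpoint chain (j : nat) : forest unit :=
  if j is i.+1 then FCons tt (chain i) FNil else FNil.

Lemma chain_shapes j : chain j \in shapes j.
Proof.
elim: j => [|j IHj]; first exact: mem_head.
apply/flatten_mapP; exists (chain j) => //.
elim: {IHj} j => [|j IHj]; first exact: mem_head.
 rewrite [chain j.+1]/= [ins _ _]/=.
rewrite inE mem_cat; apply/or3P; apply: Or32; exact: map_f.
Qed.

Lemma has_rank_chain j : has_rank j (chain j).
Proof.
have lE i : lpath (chain j) i = (i == j).
  elim: j i => [|j IHj] [|i] //.
  rewrite [lpath _ _]/= -[LHS]/(leafdist (FCons tt (chain j) FNil) i).
  by rewrite leafdist_cons IHj /= orbF.
rewrite /has_rank lE eqxx; apply/forallP => i; rewrite lE.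
by rewrite ltn_eqF.
Qed.

(** * The constant as a series of root-rank probabilities *)

Section Constant.
Variables (R : realType) (k : nat).
Local Notation mu := (@lebesgue_measure R).

Let rho (i : nat) : R := shape_mean i (@rank_ind R unit k).
Let v (i : nat) : R := rho i / ((2 * i%:R + 1) * (2 * i%:R + 3)).

Lemma mean_rank_ind01 i : 0 <= shape_mean i (@rank_ind R unit k) <= 1.
Proof.
apply/andP; split.
  rewrite -[leLHS](mean_cst i 0); apply: mean_le => F.
  by have /andP[] := rank_ind01 R k F.
rewrite -[leRHS](mean_cst i 1); apply: mean_le => F.
by have /andP[] := rank_ind01 R k F.
Qed.

Lemma mean_rank_ind_gt0 : 0 < shape_mean k (@rank_ind R unit k).
Proof.
rewrite /shape_mean divr_gt0 ?natr_size_shapes_gt0// /shape_sum (big_rem _ (chain_shapes k)) /=.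
rewrite ltr_pwDl//; first by rewrite /rank_ind has_rank_chain.
by rewrite sumr_ge0// => F _; have /andP[] := rank_ind01 R k F.
Qed.

(** Coefficients of the derivative of [B k], by [diffs_acoef]. *)
Let dcoef (n : nat) : R := shape_sum n (@rank_ind R unit k) / n`!%:R.

Let fact_neq0 n : n`!%:R != 0 :> R.
Proof. by rewrite pnatr_eq0 -lt0n fact_gt0. Qed.

Lemma size_shapes_le_fact (n : nat) : (size (shapes n))%:R / n`!%:R <= 2 ^+ n :> R.
Proof.
elim: n => [|n IHn]; first by rewrite /= fact0 divr1.
rewrite natr_size_shapesS factS natrM exprS.
have -> : (2 * n%:R + 1) * (size (shapes n))%:R / (n.+1%:R * n`!%:R) =
   ((2 * n%:R + 1) / n.+1%:R) * ((size (shapes n))%:R / n`!%:R) :> R.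
  have : n.+1%:R != 0 :> R by rewrite pnatr_eq0.
  by move: n.+1%:R => M M0; field; rewrite M0 fact_neq0.
rewrite ler_pM ?divr_ge0 ?addr_ge0 ?mulr_ge0//.
by rewrite ler_pdivrMr ?ltr0n// -natr1; lra.
Qed.

Let dcoef_ge0 n : 0 <= dcoef n.
Proof.
rewrite divr_ge0// sumr_ge0// => F _; by have /andP[] := rank_ind01 R k F.
Qed.

Let dcoef_le n : dcoef n <= 2 ^+ n.
Proof.
rewrite (le_trans _ (size_shapes_le_fact n))// ler_wpM2r ?invr_ge0//.
rewrite /shape_sum -[leRHS]mulr1 -sumr_cst ler_sum// => F _.
by have /andP[] := rank_ind01 R k F.
Qed.

Let acoef (n : nat) : R := (b k n)%:R / n`!%:R.

Let diffs_acoef : pseries_diffs acoef = dcoef.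
Proof.
apply/funext => n; rewrite /pseries_diffs /acoef /dcoef b_shapes factS natrM.
have : n.+1%:R != 0 :> R by rewrite pnatr_eq0.
by move: n.+1%:R => M M0; field; rewrite M0 fact_neq0.
Qed.

Let acoef_bound n : 0 <= acoef n <= 2 * n.+1%:R * 2 ^+ n.
Proof.
rewrite divr_ge0//=; case: n => [|n].
  have -> : acoef 0 = 0.
    rewrite /acoef /b eq_card0 ?mul0r// => t; rewrite inE.
    by apply/existsP => -[[]].
  by rewrite !mulr_ge0.
have -> : acoef n.+1 = dcoef n / n.+1%:R.
  by rewrite -diffs_acoef /pseries_diffs mulrAC divff ?mul1r// pnatr_eq0.
rewrite ler_pdivrMr ?ltr0n// (le_trans (dcoef_le n))//.
rewrite exprS; set p := 2 ^+ n.
have p0 : 0 <= p by rewrite exprn_ge0.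
have n1 : 1 <= n.+1%:R :> R by rewrite ler1n.
have n2 : 1 <= n.+2%:R :> R by rewrite ler1n.
have -> : 2 * n.+2%:R * (2 * p) * n.+1%:R = p * (4 * (n.+2%:R * n.+1%:R)).
  by move: n.+2%:R n.+1%:R => x y; ring.
rewrite ler_peMr//.
have : 1 * 1 <= n.+2%:R * n.+1%:R :> R by rewrite ler_pM.
lra.
Qed.

Let pseries_cvg (x : R) : 0 <= x -> x < 2^-1 -> cvgn (pseries dcoef x) /\
  derive1 (@B R k) x = limn (pseries dcoef x).
Proof.
(* Termwise differentiation at [x] asks that the series and its first two formal derivatives
   converge at a point beyond [x]; the midpoint between [x] and 1/2 is taken. *)
move=> x0 xlt; pose K : R := (x + 2^-1) / 2.
have K0 : 0 < K by rewrite /K; lra.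
have K1 : K < 2^-1 by rewrite /K; lra.
have xK : `|x| < `|K| by rewrite !ger0_norm ?(ltW K0)// /K; lra.
have cd : cvgn (pseries dcoef K).
  apply: (@is_cvg_pseries_lt_half _ _ 2) => // n; rewrite dcoef_ge0 /=.
  rewrite (le_trans (dcoef_le n))// ler_peMl ?exprn_ge0//.
  have : 1 <= n.+1%:R :> R by rewrite ler1n.
  lra.
split; first exact: is_cvg_pseries_inside cd xK.
have := @pseries_snd_diffs _ acoef K x; rewrite diffs_acoef => H.
have dB : is_derive x 1 (@B R k) (limn (pseries dcoef x)).
  apply: H => //; first by apply: (@is_cvg_pseries_lt_half _ _ 2).
  apply: (@is_cvg_pseries_lt_half _ _ 2) => // n; rewrite /pseries_diffs.
  have -> : 2 * n.+1%:R * 2 ^+ n = n.+1%:R * 2 ^+ n.+1 :> R.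
    by rewrite exprS; move: n.+1%:R => x0'; ring.
  by rewrite mulr_ge0//= ler_wpM2l.
by rewrite derive1E (@derive_val _ _ _ _ _ _ _ dB).
Qed.

Let s (x : R) : R := Num.sqrt (1 - 2 * x).

Let eseries_lim (u : nat -> R) (l : R) : series u @ \oo --> l ->
  (\sum_(0 <= n <oo) (u n)%:E = l%:E)%E.
Proof.
move=> ul; have -> : (fun n => (\sum_(0 <= i < n) (u i)%:E)%E) = EFin \o series u.
  by apply/funext => n; rewrite /= sumEFin.
by rewrite EFin_lim ?(cvg_lim _ ul)//; apply/cvg_ex; exists l.
Qed.

Let integrandE (x : R) : x \in `[0, 2^-1]%classic ->
  (s x * derive1 (@B R k) x)%:E =
  (\sum_(0 <= n <oo) ((dcoef n)%:E * (x ^+ n * s x)%:E))%E.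
Proof.
rewrite inE /= in_itv /= => /andP[x0]; rewrite le_eqVlt => /predU1P[->|xlt].
  (* The endpoint 1/2 is outside the range of [pseries_cvg]; there the factor [s] makes both sides
     zero. *)
  have -> : s 2^-1 = 0 by rewrite /s divff// subrr sqrtr0.
  by rewrite mul0r eseries0// => i _ _; rewrite mulr0 mule0.
have [cd ->] := pseries_cvg x0 xlt.
apply/esym; under eq_eseriesr do rewrite -EFinM.
apply: eseries_lim.
have -> : series (fun n => dcoef n * (x ^+ n * s x)) = (fun n => s x * pseries dcoef x n).
  apply/funext => n; rewrite /pseries /series /= mulr_sumr; apply: eq_bigr => i _.
  by ring.
by apply: cvgM; [exact: cvg_cst|exact: cd].
Qed.

(** The tail from [m] on of the weights [1/((2i+1)(2i+3))], obtained by telescoping. *)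
Let T (m : nat) : R := (2 * (2 * m%:R + 1))^-1.

Let v_ge0 i : 0 <= v i.
Proof.
have /andP[r0 _] := mean_rank_ind01 i.
by rewrite divr_ge0// mulr_ge0// addr_ge0// mulr_ge0.
Qed.

Let v_leT i : v i <= T i - T i.+1.
Proof.
have /andP[r0 r1] := mean_rank_ind01 i.
have i1 : 0 < 2 * i%:R + 1 :> R by rewrite ltr_wpDl// mulr_ge0.
have i3 : 0 < 2 * i%:R + 3 :> R by rewrite ltr_wpDl// mulr_ge0.
have -> : T i - T i.+1 = ((2 * i%:R + 1) * (2 * i%:R + 3))^-1.
  rewrite /T -(natr1 i).
  have -> : 2 * (i%:R + 1) + 1 = 2 * i%:R + 3 :> R by ring.
  by field; rewrite !gt_eqF.
by rewrite /v ler_piMl// invr_ge0 mulr_ge0// ltW.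
Qed.

Let T_ge0 m : 0 <= T m.
Proof. by rewrite invr_ge0 mulr_ge0// addr_ge0// mulr_ge0. Qed.

Let sum_v_le m M : (m <= M)%N -> series v M <= series v m + T m.
Proof.
move=> mM; rewrite /series /= (big_cat_nat _ mM)//= lerD2l.
rewrite (@le_trans _ _ (\sum_(m <= i < M) (T i - T i.+1)))//.
  by apply: ler_sum.
rewrite -(opprK (\sum_(_ <= _ < _) _)) -sumrN.
under eq_bigr do rewrite opprB.
by rewrite telescope_sumr// opprB lerBlDr lerDl.
Qed.

Let v_nd : nondecreasing_seq (series v).
Proof. by apply: nondecreasing_series => n _ _; exact: v_ge0. Qed.

Let v_cvg : cvgn (series v).
Proof.
apply: nondecreasing_is_cvgn => //; exists (series v 0 + T 0) => _ [n _ <-].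
exact: sum_v_le.
Qed.

(** All terms are nonnegative, so the expanded integrand may be integrated term by term; each beta
    integral then turns its coefficient into [v n]. *)
Let cE : c R k = 2 * limn (series v).
Proof.
suff E : (\int[mu]_(x in `[0%R, 2^-1%R]) (s x * derive1 (@B R k) x)%:E =
    (limn (series v))%:E)%E by rewrite /c /Rintegral E.
transitivity (\int[mu]_(x in `[0%R, 2^-1%R])
    \sum_(0 <= n <oo) ((dcoef n)%:E * (x ^+ n * s x)%:E))%E.
  by apply: eq_integral => x xI; apply: integrandE.
have mI : measurable (`[0, 2^-1]%classic : set R) by exact: measurable_itv.
have mf n : measurable_fun (`[0, 2^-1]%classic : set R) (EFin \o (fun x : R => x ^+ n * s x)).
  apply/measurable_EFinP; apply: (measurable_funS measurableT) => //.
  apply: continuous_measurable_fun => x; apply: cvgM; first exact: exprn_continuous.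
  apply: (@continuous_comp _ _ _ (fun x : R => 1 - 2 * x)); last exact: sqrt_continuous.
  by apply: cvgB; [exact: cvg_cst|apply: cvgM; [exact: cvg_cst|exact: cvg_id]].
have f0 n (x : R) : `[0, 2^-1]%classic x -> (0 <= (x ^+ n * s x)%:E)%E.
  rewrite /= in_itv /= => /andP[x0 _].
  by rewrite lee_fin mulr_ge0 ?sqrtr_ge0 ?exprn_ge0.
rewrite integral_nneseries//; last 2 first.
- by move=> n; apply: measurable_funeM; exact: mf.
- by move=> n x xI; rewrite mule_ge0 ?f0// lee_fin.
rewrite -(eseries_lim v_cvg); apply: eq_eseriesr => n _.
rewrite ge0_integralZl_EFin//; [|by move=> x; exact: f0|exact: mf].
rewrite integral_beta -EFinM; congr (_%:E).
rewrite /v -beta_prim0 /dcoef /rho /shape_mean.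
by field; rewrite fact_neq0 natr_size_shapes_neq0.
Qed.

(** The mean over [shapes m] involves only child forests smaller than [m]; truncating the series
    there costs at most twice the tail [T m]. *)
Lemma c_bounds (m : nat) :
  2 * \sum_(i < m) shape_mean i (@rank_ind R unit k) / ((2 * i%:R + 1) * (2 * i%:R + 3)) <= c R k
  <= 2 * (\sum_(i < m) shape_mean i (@rank_ind R unit k) / ((2 * i%:R + 1) * (2 * i%:R + 3)))
     + (2 * m%:R + 1)^-1.
Proof.
rewrite cE; have -> : \sum_(i < m) shape_mean i (@rank_ind R unit k) / ((2 * i%:R + 1) * (2 * i%:R + 3))
  = series v m by rewrite /series /= big_mkord.
rewrite ler_pM2l// nondecreasing_cvgn_le//=.
have -> : (2 * m%:R + 1)^-1 = 2 * T m.
  rewrite /T; field; rewrite gt_eqF// ltr_wpDl// mulr_ge0//.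
rewrite -mulrDr ler_pM2l//; apply: limr_le => //.
by exists m => // M /= mM; exact: sum_v_le.
Qed.

Lemma c_gt0 : 0 < c R k.
Proof.
have /andP[H _] := c_bounds k.+1; apply: lt_le_trans H.
rewrite mulr_gt0// big_ord_recr /= ltr_wpDl//.
  by apply: sumr_ge0 => i _; exact: v_ge0.
by rewrite divr_gt0 ?mean_rank_ind_gt0// mulr_gt0// ltr_wpDl// mulr_ge0.
Qed.

End Constant.

(** * Concentration *)

Section Concentration.
Variable R : realType.

Lemma mean_le_in (m : nat) (f g : forest unit -> R) :
  (forall F, fsize F = m -> f F <= g F) -> shape_mean m f <= shape_mean m g.
Proof.
move=> fg; rewrite ler_pM2r ?invr_gt0 ?natr_size_shapes_gt0// /shape_sum big_seq [leRHS]big_seq.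
by apply: ler_sum => F /fsize_shapes; exact: fg.
Qed.

Lemma mean_norm (m : nat) (f : forest unit -> R) :
  `|shape_mean m f| <= shape_mean m (fun F => `|f F|).
Proof.
rewrite /shape_mean normrM [X in _ * X <= _]ger0_norm ?invr_ge0//.
by rewrite ler_wpM2r ?invr_ge0// ler_norm_sum.
Qed.

Lemma meanZ (m : nat) (a : R) (f : forest unit -> R) :
  shape_mean m (fun F => a * f F) = a * shape_mean m f.
Proof. by rewrite /shape_mean /shape_sum -mulr_sumr mulrA. Qed.

Lemma eq_mean (m : nat) (f g : forest unit -> R) : f =1 g -> shape_mean m f = shape_mean m g.
Proof. by move=> fg; rewrite /shape_mean /shape_sum (eq_bigr _ (fun F _ => fg F)). Qed.

(** The bias is bounded separately, since the mean square error alone would only give a bias of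
    order [m^(-1/2)]. *)
Definition concentrated (g : nat -> forest unit -> R) (a : R) : Prop :=
  exists A : R, [/\ forall m F, fsize F = m -> `|g m F| <= A,
    forall m, `|shape_mean m (g m) - a| <= A / m.+1%:R &
    forall m, shape_mean m (fun F => (g m F - a) ^+ 2) <= A / m.+1%:R].

Lemma concentrated1 : concentrated (fun _ _ => 1) 1.
Proof.
exists 1; split=> [m F _|m|m]; first by rewrite normr1.
  by rewrite mean_cst subrr normr0 divr_ge0.
by rewrite subrr expr0n mean_cst divr_ge0.
Qed.

Lemma concentratedM g h (a a' : R) : concentrated g a -> concentrated h a' ->
  concentrated (fun m F => g m F * h m F) (a * a').
Proof.
move=> [A [gb gm gv]] [A' [hb hm hv]].
have A0 : 0 <= A by apply: le_trans (normr_ge0 _) (gb 0%N FNil erefl).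
have A'0 : 0 <= A' by apply: le_trans (normr_ge0 _) (hb 0%N FNil erefl).
(* The three groups serve the uniform bound, the bias and the mean square error of the product. *)
pose C := A * A' + (`|a| * A' + `|a'| * A + (A + A')) + (2 * A ^+ 2 * A' + 2 * a' ^+ 2 * A).
have c1 : 0 <= A * A' by rewrite mulr_ge0.
have c2 : 0 <= `|a| * A' + `|a'| * A + (A + A') by rewrite !addr_ge0// mulr_ge0.
have c3 : 0 <= 2 * A ^+ 2 * A' + 2 * a' ^+ 2 * A.
  have h1 : 0 <= A ^+ 2 * A' by rewrite mulr_ge0// sqr_ge0.
  have h2 : 0 <= a' ^+ 2 * A by rewrite mulr_ge0// sqr_ge0.
  lra.
exists C; split=> [m F Fm|m|m].
- rewrite normrM (le_trans (ler_pM _ _ (gb m F Fm) (hb m F Fm)))// /C; lra.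
(* Expansion around the limits: two biases, and a product of deviations bounded by the sum of the
   two mean square errors. *)
- have -> : shape_mean m (fun F => g m F * h m F) - a * a' =
     a * (shape_mean m (h m) - a') + a' * (shape_mean m (g m) - a) +
     shape_mean m (fun F => (g m F - a) * (h m F - a')).
    rewrite [X in _ = _ + X](@eq_mean _ _ (fun F => g m F * h m F +
       (- a * h m F + (- a' * g m F + a * a')))); last by move=> F; ring.
    by rewrite !meanD !meanZ mean_cst; ring.
  apply: (@le_trans _ _ ((`|a| * A' + `|a'| * A + (A + A')) / m.+1%:R)); last first.
    by rewrite ler_wpM2r ?invr_ge0// /C; lra.
  rewrite !mulrDl (le_trans (ler_normD _ _))// lerD//.
    rewrite (le_trans (ler_normD _ _))// !normrM -!mulrA lerD// ler_wpM2l//.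
  rewrite (le_trans (mean_norm _ _))//.
  apply: (@le_trans _ _ (shape_mean m (fun F => (g m F - a) ^+ 2 + (h m F - a') ^+ 2))).
    apply: mean_le => F; move: (g m F - a) (h m F - a') => x y.
    have := sqr_ge0 (x - y); have := sqr_ge0 (x + y); rewrite ler_norml !expr2 => h1 h2.
    by have := mulr_ge0 (ler0n R 2) (sqr_ge0 x); have := sqr_ge0 y; rewrite !expr2; nra.
  by rewrite meanD lerD.
- apply: (@le_trans _ _ (shape_mean m (fun F => 2 * A ^+ 2 * (h m F - a') ^+ 2 +
      2 * a' ^+ 2 * (g m F - a) ^+ 2))).
    apply: mean_le_in => F Fm.
    (* One factor is replaced by its limit at a time; the uniform bound on [g] controls the first
       term. *)
    have -> : g m F * h m F - a * a' = g m F * (h m F - a') + a' * (g m F - a) by ring.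
    have gA : g m F ^+ 2 <= A ^+ 2.
      by rewrite -[leLHS]real_normK ?num_real// ler_sqr ?nnegrE// gb.
    move: (g m F * (h m F - a')) (a' * (g m F - a))
      (exprMn 2 (g m F) (h m F - a')) (exprMn 2 a' (g m F - a)) => x y ex ey.
    apply: (@le_trans _ _ (2 * x ^+ 2 + 2 * y ^+ 2)).
      by have := sqr_ge0 (x - y); rewrite !expr2; lra.
    rewrite ex ey; move: (sqr_ge0 (h m F - a')) gA.
    move: ((h m F - a') ^+ 2) (_ ^+ 2) (_ ^+ 2) (_ ^+ 2) (_ ^+ 2) => u p q w z u0 qp.
    by have := ler_wpM2r u0 qp; lra.
  rewrite meanD !meanZ.
  apply: (@le_trans _ _ ((2 * A ^+ 2 * A' + 2 * a' ^+ 2 * A) / m.+1%:R)); last first.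
    by rewrite ler_wpM2r ?invr_ge0// /C; lra.
  have hA : 0 <= 2 * A ^+ 2 by rewrite mulr_ge0// sqr_ge0.
  have ha : 0 <= 2 * a' ^+ 2 by rewrite mulr_ge0// sqr_ge0.
  have := ler_wpM2l hA (hv m); have := ler_wpM2l ha (gv m); rewrite !mulrA => h1 h2.
  by rewrite [leRHS]mulrDl; apply: lerD.
Qed.

Lemma concentrated_prod (I : Type) (s : seq I) (g : I -> nat -> forest unit -> R)
    (a : I -> R) : (forall i, concentrated (g i) (a i)) ->
  concentrated (fun m F => \prod_(i <- s) g i m F) (\prod_(i <- s) a i).
Proof.
move=> ga; elim: s => [|i s IHs].
  rewrite big_nil (_ : (fun _ _ => _) = (fun _ _ => 1)); first exact: concentrated1.
  by apply/funext => m; apply/funext => F; rewrite big_nil.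
rewrite big_cons (_ : (fun _ _ => _) = (fun m F => g i m F * \prod_(i <- s) g i m F)).
  exact: concentratedM.
by apply/funext => m; apply/funext => F; rewrite big_cons.
Qed.

Lemma rank_count_bound (k : nat) (F : forest unit) :
  0 <= rank_count R k F <= (fsize F).+1%:R.
Proof.
have H : 0 <= nodesum (rank_ind R k) F <= (fsize F)%:R.
  elim: F => [|a l IHl r IHr] /=; first by rewrite lexx.
  by have := rank_ind01 R k l; rewrite -natr1 natrD; lra.
by have := rank_ind01 R k F; rewrite /rank_count -natr1; lra.
Qed.

(** By [mean_nodesum] the mean is the root's probability plus [2m+1] times a truncated sum, and by
    [c_bounds] twice this sum is within [1/(2m+1)] of the constant. *)
Lemma mean_rank_count (k m : nat) :
  `|shape_mean m (rank_count R k) - m.+1%:R * c R k| <= 1 + c R k.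
Proof.
have -> : shape_mean m (rank_count R k) = shape_mean m (rank_ind R k) + shape_mean m (nodesum (rank_ind R k)).
  exact: meanD.
rewrite mean_nodesum.
have := c_bounds R k m; have := mean_rank_ind01 R k m; have := c_gt0 R k.
move: (\sum_(i < m) _) (shape_mean m _) (c R k) => S r x x0 r01 /andP[Sx xS].
have S0 : S <= x / 2 by lra.
have m0 : 0 <= m%:R :> R by [].
have Mx : m%:R * (2 * S) <= m%:R * x by rewrite ler_wpM2l.
have xM : (m%:R + 1) * x <= (m%:R + 1) * (2 * S) + 1.
  apply: (@le_trans _ _ ((m%:R + 1) * (2 * S + (2 * m%:R + 1)^-1))).
    by rewrite ler_wpM2l//; lra.
  rewrite mulrDr lerD2l ler_pdivrMr; lra.
rewrite -(natr1 m) ler_norml; nra.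
Qed.

Lemma concentrated_rank_count (k : nat) :
  concentrated (fun m F => rank_count R k F / m.+1%:R) (c R k).
Proof.
have c0 := c_gt0 R k.
pose C := 2 * k%:R + 3 : R.
(* The summands serve the uniform bound, the bias and the mean square error, which is the variance
   plus the squared bias. *)
exists (1 + (1 + c R k) + (C ^+ 2 + (1 + c R k) ^+ 2)).
have C2 : 0 <= C ^+ 2 by exact: sqr_ge0.
have D2 : 0 <= (1 + c R k) ^+ 2 by exact: sqr_ge0.
have M0 m : 0 < m.+1%:R :> R by rewrite ltr0n.
have mE m : shape_mean m (fun F => rank_count R k F / m.+1%:R) = shape_mean m (rank_count R k) / m.+1%:R.
  by rewrite (eq_mean _ (fun F => mulrC _ _)) meanZ mulrC.
split=> [m F Fm|m|m].
- have := rank_count_bound k F; rewrite Fm => /andP[r0 r1].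
  rewrite ger0_norm ?divr_ge0// (@le_trans _ _ 1)//; last by lra.
  by rewrite ler_pdivrMr// mul1r.
- have M1 : m.+1%:R != 0 :> R by rewrite gt_eqF.
  rewrite mE -[X in _ / _ - X](mulfK M1) -mulrBl normrM.
  rewrite [X in _ * X](ger0_norm _) ?invr_ge0// ler_wpM2r ?invr_ge0//.
  by rewrite [_ * m.+1%:R]mulrC (le_trans (mean_rank_count _ _))//; lra.
- have V := lip_variance m (@lip_rank_count R unit k).
  have E := mean_rank_count k m.
  have M1 : m.+1%:R != 0 :> R by rewrite gt_eqF.
  set x := shape_mean m (rank_count R k) in V E; set y := shape_mean m _ in V.
  have -> : shape_mean m (fun F => (rank_count R k F / m.+1%:R - c R k) ^+ 2) =
      (y - x ^+ 2 + (x - m.+1%:R * c R k) ^+ 2) / m.+1%:R ^+ 2.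
    rewrite (@eq_mean _ _ (fun F => m.+1%:R^-2 * rank_count R k F ^+ 2 +
       (- (2 * c R k / m.+1%:R) * rank_count R k F + c R k ^+ 2))).
      by rewrite meanD meanZ meanD meanZ mean_cst -/x -/y; move: m.+1%:R M1 => M M1; field.
    by move=> F; move: m.+1%:R M1 => M M1; field.
  have E2 : (x - m.+1%:R * c R k) ^+ 2 <= (1 + c R k) ^+ 2.
    by rewrite -[leLHS]real_normK ?num_real// ler_sqr ?nnegrE//; lra.
  rewrite expr2 invfM mulrA ler_wpM2r ?invr_ge0// ler_pdivrMr//.
  have m0 : 0 <= m%:R :> R by [].
  rewrite -/C in V.
  have := mulr_ge0 m0 D2; have := mulr_ge0 m0 (ltW c0).
  move: (C ^+ 2) ((1 + _) ^+ 2) C2 D2 V E2 => C' D' C2 D2 V E2 h1 h2.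
  by rewrite -(natr1 m); nra.
Qed.

End Concentration.

(** * Asymptotics of the expectation *)

Lemma X_mean_bound (R : realType) (r m : nat) (k : r.-tuple nat) :
  `|unif_expectation (fun t : pit m.+1 => (X k t)%:R : R) / m.+1%:R ^+ r -
    shape_mean m (fun F => \prod_(j < r) (rank_count R (tnth k j) F / m.+1%:R))|
  <= (r ^ 2)%:R / m.+1%:R.
Proof.
have M0 : 0 < m.+1%:R :> R by rewrite ltr0n.
have -> : shape_mean m (fun F => \prod_(j < r) (rank_count R (tnth k j) F / m.+1%:R)) =
    unif_expectation (fun t : pit m.+1 =>
      \prod_(j < r) (rank_count R (tnth k j) (shape_of t) / m.+1%:R)).
  rewrite /unif_expectation card_pit.
  by rewrite (@sum_pit m R (fun F => \prod_(j < r) (rank_count R (tnth k j) F / m.+1%:R))).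
rewrite /unif_expectation; set p := #|_|%:R.
have p0 : 0 < p by rewrite ltr0n card_pit size_shapes_gt0.
rewrite mulrAC -mulrBl normrM [X in _ * X]ger0_norm ?invr_ge0 ?(ltW p0)//.
rewrite ler_pdivrMr// mulr_suml -sumrB (le_trans (ler_norm_sum _ _ _))//.
rewrite /p mulr_natr -sumr_const; apply: ler_sum => t _.
have -> : \prod_(j < r) (rank_count R (tnth k j) (shape_of t) / m.+1%:R) =
    (\prod_(j < r) #|[set v | rank t v == tnth k j]%SET|)%:R / m.+1%:R ^+ r.
  rewrite natr_prod big_split /= prodr_const card_ord exprVn.
  by congr (_ * _); apply: eq_bigr => j _; rewrite rank_count_shape.
have h1 := X_le_prod k t; have h2 := prod_le_X k t.
rewrite -mulrBl normrM [X in _ * X]ger0_norm ?invr_ge0 ?exprn_ge0//.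
rewrite ler_pdivrMr ?exprn_gt0// distrC ger0_norm ?subr_ge0 ?ler_nat//.
(* After multiplication by the number of vertices the claim for a single tree is [prod_le_X]. *)
rewrite -(ler_pM2l M0) mulrBr lerBlDl mulrA mulrCA divff ?gt_eqF// mulr1.
by rewrite -!natrX -!natrM -natrD ler_nat.
Qed.

Unset Implicit Arguments.

Theorem theorem3p8 (R : realType) (r : nat) (r_ge1 : (1 <= r)%N)
    (k : r.-tuple nat) :
  exists eps : nat -> R,
    eps =O_\oo (fun n : nat => n%:R^-1 : R) /\
    forall n : nat, (1 <= n)%N ->
      unif_expectation (fun t : pit n => (X k t)%:R : R) =
      (1 + eps n) * n%:R ^+ r * \prod_(j < r) c R (tnth k j).
Proof.
pose p : R := \prod_(j < r) c R (tnth k j).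
have p0 : 0 < p by apply: prodr_gt0 => j _; exact: c_gt0.
pose E (n : nat) : R := unif_expectation (fun t : pit n => (X k t)%:R : R).
have [A [_ HA _]] := concentrated_prod (index_enum 'I_r)
  (fun j : 'I_r => concentrated_rank_count R (tnth k j)).
pose C := (r ^ 2)%:R + A.
(* The relative error; dividing by [p] is legitimate because all the constants are positive. *)
exists (fun n => E n / n%:R ^+ r / p - 1); split; last first.
  move=> n n1; rewrite -/(E n) -/p addrC subrK.
  by field; rewrite gt_eqF// expf_neq0// pnatr_eq0 -lt0n.
(* Two errors of order [1/n] add up: repeated vertices, and the bias of the product of normalized
   counts. *)
have bound m : `|E m.+1 / m.+1%:R ^+ r - p| <= C / m.+1%:R.
  rewrite mulrDl; apply: le_trans (lerD (@X_mean_bound R r m k) (HA m)).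
  by rewrite (le_trans _ (ler_normD _ _))// addrA subrK.
apply/eqOP; exists (C / p); split; first exact: num_real.
move=> K CK; exists 1%N => // -[//|m] _ /=.
have M0 : 0 < m.+1%:R :> R by rewrite ltr0n.
rewrite [X in _ <= _ * X]ger0_norm ?invr_ge0//.
have -> : E m.+1 / m.+1%:R ^+ r / p - 1 = (E m.+1 / m.+1%:R ^+ r - p) / p.
  by rewrite mulrBl divff// gt_eqF.
rewrite normrM [X in _ * X <= _]gtr0_norm ?invr_gt0//.
apply: (@le_trans _ _ (C / m.+1%:R / p)); first by rewrite ler_wpM2r ?invr_ge0 ?(ltW p0).
by rewrite mulrAC ler_wpM2r ?invr_ge0// ltW.
Qed.
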